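(* Let $k$ be a positive integer and let $G$ be a $k$-splittable graph. Then the arboricity $a(G)$ and the pseudoarboricity $p(G)$ satisfy $a(G)\le 3k+1$ and $p(G)\le 3k$. Therefore arboricity (respectively, pseudoarboricity) approximates the planar split thickness within factor $3+1/k$ (respectively, $3$); that is, if $k$ is the planar split thickness of $G$, then $$k\le a(G)\le \left(3+\tfrac1k\right)k\quad\text{and}\quad k\le p(G)\le 3k.$$
   Context: Graphs are finite and simple. For a positive integer $k$, a $k$-split operation at a vertex $v$ of a graph inserts at most $k$ new vertices $v_1,\dots,v_k$ (the copies of $v$), then, for each neighbor $w$ of $v$, adds at least one edge $(v_i,w)$ with $i\in[1,k]$, and finally deletes $v$ along with its incident edges. A $k$-split of a graph $G$ is a graph obtained by applying a $k$-split operation to each vertex of $G$ at most once. A graph $G$ is $k$-splittable if some $k$-split of $G$ is planar. The planar split thickness of $G$ is the minimum positive integer $k$ such that $G$ is $k$-splittable. The arboricity $a(G)$ is the minimum positive integer such that the edges of $G$ can be decomposed into $a(G)$ forests. A pseudoforest is a graph containing at most one cycle per connected component, and the pseudoarboricity $p(G)$ is the minimum positive integer such that the edges of $G$ can be decomposed into $p(G)$ pseudoforests. *)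

(* Defs.v *)
From HB Require Import structures.
From mathcomp Require Import all_boot all_order all_algebra.
From mathcomp Require Import boolp classical_sets reals topology normedtype.
Import Order.TTheory GRing.Theory Num.Theory.
Import numFieldNormedType.Exports.

Set Implicit Arguments.
Unset Strict Implicit.
Unset Printing Implicit Defensive.

Record sgraph := SGraph {
  vertex :> finType;
  adj : rel vertex;
  adj_sym : symmetric adj;
  adj_irrefl : irreflexive adj }.

Arguments adj {_}.

(* [split_op k v pi]: [H] results from [G] by a [k]-split operation at [v].
   The map [pi] sends each copy of [v] to [v] and each surviving vertex to
   itself, so [H] is only determined up to isomorphism. Copies of [v] are
   pairwise non-adjacent by the fourth clause, as [adj] is irreflexive. *)
Definition split_op (k : nat) (G H : sgraph) (v : G) (pi : H -> G) : Prop :=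
  [/\ (forall w : G, w != v -> #|[pred x | pi x == w]| = 1),
      #|[pred x | pi x == v]| <= k,
      (forall x y : H, pi x != v -> pi y != v -> adj x y = adj (pi x) (pi y)),
      (forall x y : H, pi x = v -> adj x y -> adj v (pi y)) &
      (forall y : H, adj v (pi y) -> exists2 x : H, pi x = v & adj x y)].

(* [splits_on k U H]: [H] is reached from [G] by successive [k]-split
   operations, where [U] is the set of vertices that may still be split;
   neither a split vertex nor its copies may be split afterwards. *)
Inductive splits_on (k : nat) : forall G : sgraph, {set G} -> sgraph -> Prop :=
| SplitsNil (G : sgraph) (U : {set G}) : splits_on k U G
| SplitsCons (G H K : sgraph) (U : {set G}) (v : G) (pi : H -> G) :
    v \in U -> split_op k v pi ->
    splits_on k (pi @^-1: (U :\ v)) K -> splits_on k U K.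

Definition k_split (k : nat) (G H : sgraph) : Prop := splits_on k [set: G] H.

Section Arc.
Local Open Scope classical_set_scope.
Local Open Scope ring_scope.

Definition arc_between (R : realType) (a b : R * R) (A : set (R * R)) : Prop :=
  exists f : R -> R * R,
    [/\ {within `[0, 1], continuous f}, {in `[0, 1] &, injective f},
        f 0 = a, f 1 = b & A = f @` `[0, 1]].

End Arc.

Section Planarity.
Variable R : realType.

(* The edge joining [x] and [y] is the unordered pair [[set x; y]]; the values
   of [arc] at sets that are not edges are irrelevant. *)
Definition plane_drawing (G : sgraph) (pos : G -> R * R)
    (arc : {set G} -> set (R * R)) : Prop :=
  [/\ injective pos,
      (forall x y : G, adj x y ->
         arc_between (pos x) (pos y) (arc [set x; y])),
      (forall x y z : G, adj x y ->
         arc [set x; y] (pos z) -> z \in [set x; y]) &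
      (forall x y z w : G, adj x y -> adj z w -> [set x; y] != [set z; w] ->
         forall P : R * R, arc [set x; y] P -> arc [set z; w] P ->
         exists2 u : G, u \in [set x; y] :&: [set z; w] & P = pos u)].

Definition planar (G : sgraph) : Prop :=
  exists pos arc, @plane_drawing G pos arc.

Definition splittable (k : nat) (G : sgraph) : Prop :=
  exists2 H : sgraph, k_split k G H & planar H.

End Planarity.

(* The least positive integer satisfying [P]; the junk value 0 arises only if
   no positive integer satisfies [P]. *)
Definition least_pos (P : nat -> Prop) : nat :=
  xget 0 (fun n => [/\ 0 < n, P n & forall m, 0 < m -> P m -> n <= m]).

Lemma least_posP (P : nat -> Prop) : (exists2 n, 0 < n & P n) ->
  [/\ 0 < least_pos P, P (least_pos P) &
      forall m, 0 < m -> P m -> least_pos P <= m].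
Proof.
case=> n n_gt0 Pn.
have exQ : exists i, (0 < i) && `[< P i >].
  by exists n; rewrite n_gt0; apply/asboolP.
rewrite /least_pos; case: xgetP => // nope.
case: (ex_minnP exQ) => m /andP[m_gt0 /asboolP Pm] m_min.
exfalso; apply: (nope m); split=> // i i_gt0 Pi.
by apply: m_min; rewrite i_gt0; apply/asboolP.
Qed.

Definition planar_split_thickness (R : realType) (G : sgraph) : nat :=
  least_pos (fun k => splittable R k G).

Definition is_cycle (G : sgraph) (p : seq G) : bool :=
  [&& 2 < size p, uniq p & cycle adj p].

Definition cycle_edges (G : sgraph) (p : seq G) : {set {set G}} :=
  [set [set x; next p x] | x in p].

Definition forest (G : sgraph) : Prop := forall p : seq G, ~~ is_cycle p.

(* Two vertex sequences denote the same cycle when their edge sets agree. *)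
Definition pseudoforest (G : sgraph) : Prop :=
  forall p q : seq G, is_cycle p -> is_cycle q ->
    (exists x y, [/\ x \in p, y \in q & connect adj x y]) ->
    cycle_edges p = cycle_edges q.

Section ColorClass.
Variables (G : sgraph) (n : nat) (c : {set G} -> 'I_n) (i : 'I_n).

Definition class_adj : rel G := fun x y => adj x y && (c [set x; y] == i).

Lemma class_adj_sym : symmetric class_adj.
Proof. by move=> x y; rewrite /class_adj adj_sym finset.setUC. Qed.

Lemma class_adj_irrefl : irreflexive class_adj.
Proof. by move=> x; rewrite /class_adj adj_irrefl. Qed.

Definition color_class : sgraph := SGraph class_adj_sym class_adj_irrefl.

End ColorClass.

(* A decomposition of the edges into [n] classes is an [n]-colouring of the
   edges; the colours of sets that are not edges are irrelevant. *)
Definition decomposes (P : sgraph -> Prop) (G : sgraph) (n : nat) : Prop :=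
  exists c : {set G} -> 'I_n, forall i : 'I_n, P (color_class c i).

Definition arboricity (G : sgraph) : nat := least_pos (decomposes forest G).

Definition pseudoarboricity (G : sgraph) : nat :=
  least_pos (decomposes pseudoforest G).

(* Main.v *)
Require Import Defs.
From HB Require Import structures.
From mathcomp Require Import boolp classical_sets reals topology normedtype.
From mathcomp Require Import prodnormedzmodule interval_inference.
From mathcomp Require Import all_boot all_order all_algebra.
From mathcomp Require Import zify ring lra.
From Stdlib Require Import Btauto.
Import Order.TTheory GRing.Theory Num.Theory.
Import numFieldNormedType.Exports ProdNormedZmodule.Exports.

Set Implicit Arguments.
Unset Strict Implicit.
Unset Printing Implicit Defensive.

(** Both upper bounds come from sparsity. If [H] is a planar [k]-split of [G],
    every edge of [G] inside a vertex set [S] lifts to an edge of [H] between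
    copies of vertices of [S], and [S] has at most [k * #|S|] copies; as a planar
    graph has at most three times as many edges as vertices, [S] spans at most
    [3 * k * #|S|] edges ([splittable_arcs]). Hakimi's theorem
    ([bounded_ownership]) then lets every edge be owned by one of its ends so
    that no vertex owns more than [3 * k] edges, and numbering the edges owned by
    each vertex gives [3 * k] classes in which a vertex owns at most one edge,
    which are pseudoforests. Nash-Williams' theorem ([nash_williams]) gives
    [3 * k + 1] forests: a set of [w] vertices spans at most
    [(3 * k + 1) * (w - 1)] edges, for small [w] because the graph is simple and
    for large [w] by sparsity. Both theorems are instances of Edmonds' matroid
    partition theorem ([matroid_cover]), for one uniform matroid on the edges at
    each vertex and for copies of the graphic matroid.

    The edge bound for graphs drawn with arbitrary continuous arcs uses the van
    Kampen obstruction modulo 2, which avoids the Jordan curve theorem and Euler's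
    formula. For disjoint arcs [p] and [q], the map [(s, t) |-> p s - q t] sends
    the unit square to the punctured plane, so its boundary loop does not wind
    around the origin. The four sides of the loop are [p] seen from the ends of
    [q] and [q] seen from the ends of [p]; counting how often each of them crosses
    a fixed ray, modulo 2, gives the identity [arcs_exchange], and with it a
    combinatorial structure on every planar graph ([crossing_parity]). This
    structure passes to subgraphs and to edge contractions ([parity_contract]),
    while [K5] and [K33] do not carry it. A graph carrying it therefore has at
    most [3 n - 6] edges ([parity_edge_bound]): either some edge lies in at most
    two triangles and contracting it loses at most three edges, or a vertex of
    degree at most 5 shows a [K5] or a [K33] in its neighbourhood.

    For the lower bounds, a pseudoforest can be laid out on a line so that no two
    edges interleave ([pseudoforest_noncrossing]): leaves are inserted next to
    their neighbours, and what remains is a disjoint union of cycles. Replacing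
    the line by a parabola and the edges by chords draws it in the plane. Given a
    decomposition of [G] into [n] pseudoforests, splitting each vertex into one
    copy for each class yields the disjoint union of the classes, which is
    planar, so [G] is [n]-splittable ([pseudoforests_splittable]). Forests being
    pseudoforests, the planar split thickness is at most both the
    pseudoarboricity and the arboricity. *)

(** * Matroid partition *)

Section MatroidCover.
Variables (E I : finType) (sp : I -> {set E} -> E -> bool).

(** A matroid is given here by its closure operator, [s A e] saying that [A]
    spans [e]; the third clause is the MacLane-Steinitz exchange property. *)
Definition closure_matroid (s : {set E} -> E -> bool) :=
  [/\ forall (A : {set E}) e, e \in A -> s A e,
      forall (A B : {set E}) e, (forall x, x \in B -> s A x) -> s B e -> s A e &
      forall (A : {set E}) e f, s (e |: A) f -> ~~ s A f -> s (f |: A) e].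

Definition indep (s : {set E} -> E -> bool) (A : {set E}) :=
  [forall x in A, ~~ s (A :\ x) x].

Lemma indepP (s : {set E} -> E -> bool) (A : {set E}) :
  reflect (forall x, x \in A -> ~~ s (A :\ x) x) (indep s A).
Proof. exact: forall_inP. Qed.

Section OneMatroid.
Variable s : {set E} -> E -> bool.
Hypothesis mat : closure_matroid s.

Lemma span_mono (A B : {set E}) e : A \subset B -> s A e -> s B e.
Proof.
case: mat => refl tr _ sAB; apply: tr => x xA; apply: refl.
exact: (subsetP sAB).
Qed.

Lemma indepS (A B : {set E}) : A \subset B -> indep s B -> indep s A.
Proof.
move=> sAB /indepP iB; apply/indepP => x xA.
apply: contra (iB x (subsetP sAB x xA)); apply: span_mono.
exact: setSD.
Qed.

Lemma indepU1 (A : {set E}) e : indep s A -> ~~ s A e -> indep s (e |: A).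
Proof.
case: (mat) => refl tr ex /indepP iA nAe.
have eA : e \notin A by apply: contra nAe; exact: refl.
apply/indepP => x; rewrite in_setU1; case/predU1P => [-> | xA].
  by rewrite setU1K.
have neq_xe : e != x by apply: contraNneq eA => ->.
have -> : (e |: A) :\ x = e |: (A :\ x).
  by apply/setP=> y; rewrite !inE; case: (eqVneq y e) => // ->; rewrite neq_xe.
apply: contra nAe => h; move: (ex _ _ _ h (iA x xA)).
by rewrite setD1K.
Qed.

(** The elements of [A] that can be traded for [e] form the rest of the
    unique circuit of [e |: A]: every minimal subset of [A] spanning [e] consists
    of such elements. *)
Lemma circuit_span (A : {set E}) e : indep s A -> s A e -> e \notin A ->
  s [set f in A | ~~ s (A :\ f) e] e.
Proof.
case: (mat) => refl tr ex /indepP iA sAe eA.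
have [B mB sBA] := @minset_exists _ (fun B => s B e) _ sAe.
have [sBe Bmin] := minsetP mB.
apply: span_mono (sBe); apply/subsetP => f fB; rewrite inE (subsetP sBA) //=.
have nBf : ~~ s (B :\ f) e.
  apply/negP=> h; have := Bmin _ h (subsetDl _ _) => /setP/(_ f).
  by rewrite !inE eqxx fB.
apply: contra (iA f (subsetP sBA f fB)) => sAf.
have : s (e |: (B :\ f)) f by apply: (ex _ _ _ _ nBf); rewrite setD1K.
apply: (tr) => x; rewrite in_setU1 => /predU1P[-> // | xB].
by apply: refl; apply: subsetP xB; apply: setSD.
Qed.

End OneMatroid.

Hypothesis mats : forall i, closure_matroid (sp i).
Variable X : {set E}.

(** Partial colourings: [None] marks the elements that have no colour yet. *)
Definition colour_class (c : {ffun E -> option I}) i := [set e in X | c e == Some i].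
Definition valid c := [forall i, indep (sp i) (colour_class c i)].
Definition uncovered (c : {ffun E -> option I}) := [set e in X | c e == None].

Definition swap (c : {ffun E -> option I}) e f i : {ffun E -> option I} :=
  [ffun x => if x == e then Some i else if x == f then None else c x].

Definition recolour (c : {ffun E -> option I}) e i : {ffun E -> option I} :=
  [ffun x => if x == e then Some i else c x].

(** The exchanges that keep all classes independent: [e] takes the place of an
    element [f] of the circuit that it closes in class [i], and [f] loses its
    colour. *)
Definition swap_step (c c' : {ffun E -> option I}) :=
  [exists e in uncovered c, exists i, exists f in colour_class c i,
     ~~ sp i (colour_class c i :\ f) e && (c' == swap c e f i)].

Lemma colour_class_recolour c e i j : e \in uncovered c ->
  colour_class (recolour c e i) j = if j == i then e |: colour_class c i else colour_class c j.
Proof.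
rewrite inE => /andP[eX /eqP ce]; apply/setP=> x; rewrite inE ffunE.
case: (eqVneq j i) => [-> | ji]; rewrite !inE; case: (eqVneq x e) => [-> | xe] //=.
- by rewrite eX eqxx.
- rewrite ce andbF; apply/andP => -[_ /eqP[]] ij.
  by rewrite ij eqxx in ji.
Qed.

Lemma colour_class_swap c e f i j : e \in uncovered c -> f \in colour_class c i ->
  colour_class (swap c e f i) j = if j == i then e |: (colour_class c i :\ f) else colour_class c j.
Proof.
rewrite !inE => /andP[eX /eqP ce] /andP[fX /eqP cf].
apply/setP=> x; rewrite inE ffunE.
case: (eqVneq j i) => [-> | ji]; rewrite !inE; case: (eqVneq x e) => [-> | xe] //=.
- by rewrite eX eqxx.
- by case: (eqVneq x f) => [-> | xf] /=; rewrite ?andbF.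
- by rewrite ce andbF; apply/andP => -[_ /eqP[]] ij; rewrite ij eqxx in ji.
- case: (eqVneq x f) => [-> | xf] //=; rewrite cf andbF; apply/esym/andP => -[_ /eqP[]] ij.
  by rewrite ij eqxx in ji.
Qed.

Lemma uncovered_swap c e f i : e \in uncovered c -> f \in colour_class c i ->
  uncovered (swap c e f i) = f |: (uncovered c :\ e).
Proof.
rewrite !inE => /andP[eX /eqP ce] /andP[fX /eqP cf].
apply/setP=> x; rewrite !inE ffunE; case: (eqVneq x e) => [-> | xe] /=.
  rewrite andbF orbF; apply/esym/negbTE; apply/eqP=> ef.
  by move: cf; rewrite -ef ce.
by case: (eqVneq x f) => [-> | xf] /=; rewrite ?fX.
Qed.

Lemma uncovered_recolour c e i : e \in uncovered c ->
  uncovered (recolour c e i) = uncovered c :\ e.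
Proof.
move=> _; apply/setP=> x; rewrite !inE ffunE.
by case: (eqVneq x e) => _ /=; rewrite ?andbF.
Qed.

Lemma sum_colour_class (c : {ffun E -> option I}) (W : {set I}) (D : {set E}) : D \subset X ->
  \sum_(i in W) #|colour_class c i :&: D| = #|[set e in D | if c e is Some i then i \in W else false]|.
Proof.
move=> DX; transitivity (\sum_(i in W) \sum_(e in D) (c e == Some i)).
  apply: eq_bigr => i _; rewrite -sum1_card big_mkcond [RHS]big_mkcond.
  apply: eq_bigr => e _; rewrite !inE; case eD: (e \in D); rewrite ?andbF //.
  by rewrite (subsetP DX e eD) /=; case: eqP.
rewrite exchange_big -sum1_card /= [RHS]big_mkcond [LHS]big_mkcond; apply: eq_bigr => e _.
rewrite inE; case: (e \in D) => //=; case: (c e) => [i|]; last by rewrite big1.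
case: (boolP (i \in W)) => iW; last first.
  rewrite big1 // => j jW; case: eqP => // -[ij].
  by rewrite ij jW in iW.
rewrite (bigD1 i) //= eqxx big1 ?addn0 // => j /andP[_ ji].
by case: eqP => // -[ij]; rewrite ij eqxx in ji.
Qed.

(** Edmonds' matroid partition theorem, in the form that it is applied in below.
    The obstruction [D] consists of all elements that can be left uncoloured by
    exchanges from a valid colouring with as few uncoloured elements as possible.
    If some [e] is uncoloured after such exchanges, minimality makes each class
    span it, and by [circuit_span] so does the part of the class that [e] could
    replace, which lies in [D]. Pulling this back along the exchanges shows that
    the initial classes, restricted to [D], span [D]. *)
Lemma matroid_cover :
  (exists2 c : {ffun E -> option I}, valid c & uncovered c = set0) \/
  (exists c : {ffun E -> option I}, exists e0, exists D : {set E},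
     [/\ D \subset X, e0 \in D, c e0 = None &
         forall i e, e \in D -> sp i (colour_class c i :&: D) e]).
Proof.
pose cempty : {ffun E -> option I} := [ffun=> None].
have v00 : valid cempty.
  by apply/forallP=> i; apply/indepP=> x; rewrite inE ffunE andbF.
case: (arg_minnP (fun c => #|uncovered c|) v00) => c0 vc0 min0.
have [u0 | [e0 e0U]] := set_0Vmem (uncovered c0); [by left; exists c0 | right].
pose D := [set e | [exists c, connect swap_step c0 c && (e \in uncovered c)]].
exists c0, e0, D.
have inv c : connect swap_step c0 c -> valid c /\ #|uncovered c| = #|uncovered c0|.
  move=> /connectP[p]; elim/last_ind: p c => [|p c1 IH] c /=; first by move=> _ ->.
  rewrite rcons_path last_rcons => /andP[pp st] ->; have [vl cl] := IH _ pp erefl.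
  case/exists_inP: st => e eU /existsP[i /exists_inP[f fi /andP[nsp /eqP ->]]].
  split.
    apply/forallP=> j; rewrite colour_class_swap //; case: eqP => [-> | _]; last exact: (forallP vl).
    apply: (indepU1 (mats i)) => //; apply: (indepS (mats i)) (forallP vl i).
    exact: subsetDl.
  rewrite uncovered_swap // -cl cardsU1 (cardsD1 e (uncovered _)) eU !inE.
  by move: fi; rewrite inE => /andP[fX /eqP ->] /=; rewrite !andbF.
have Dsub : D \subset X.
  by apply/subsetP=> e; rewrite inE => /existsP[c /andP[_]]; rewrite inE => /andP[].
have span_uncovered c e i : connect swap_step c0 c -> e \in uncovered c ->
    sp i (colour_class c i :&: D) e.
  move=> rc eU; have [vc uc] := inv _ rc.
  have ne : e \notin colour_class c i.
    by move: eU; rewrite !inE => /andP[_ /eqP ->]; rewrite andbF.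
  have se : sp i (colour_class c i) e.
    apply/negPn/negP => nse.
    have vr : valid (recolour c e i).
      apply/forallP=> j; rewrite colour_class_recolour //; case: eqP => [-> | _]; last exact: (forallP vc).
      exact: (indepU1 (mats i)) (forallP vc i) nse.
    have := min0 _ vr; rewrite -uc uncovered_recolour //.
    by rewrite [X in X <= _](cardsD1 e) eU ltnn.
  have := circuit_span (mats i) (forallP vc i) se ne.
  apply: (span_mono (mats i)); apply/subsetP=> f; rewrite in_set => /andP[fi nf].
  rewrite inE fi inE; apply/existsP; exists (swap c e f i).
  rewrite uncovered_swap // setU11 andbT; apply: connect_trans rc _; apply: connect1.
  apply/exists_inP; exists e => //; apply/existsP; exists i.
  by apply/exists_inP; exists f => //; rewrite nf eqxx.
(* An exchange inside [D] does not enlarge the span of a class within [D]. *)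
have back c i x : connect swap_step c0 c ->
    sp i (colour_class c i :&: D) x -> sp i (colour_class c0 i :&: D) x.
  move=> /connectP[p]; elim/last_ind: p c x => [|p c1 IH] c x /=; first by move=> _ ->.
  rewrite rcons_path last_rcons => /andP[pp st] -> sx.
  apply: IH (pp) erefl _; have rl : connect swap_step c0 (last c0 p).
    by apply/connectP; exists p.
  set l := last c0 p in st rl *.
  case/exists_inP: st sx => e eU /existsP[j /exists_inP[f fi /andP[nsp /eqP ->]]].
  have [refl tr _] := mats i; apply: tr => y; rewrite inE colour_class_swap // => /andP[].
  case: (eqVneq i j) => [<- | _] yc yD; last by apply: refl; rewrite inE yc.
  move: yc; rewrite in_setU1 => /predU1P[-> | ]; first exact: span_uncovered.
  by rewrite in_setD1 => /andP[_ yc]; apply: refl; rewrite inE yc.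
split=> //.
- by rewrite inE; apply/existsP; exists c0; rewrite connect0.
- by move: e0U; rewrite inE => /andP[_ /eqP].
- move=> i e; rewrite inE => /existsP[c /andP[rc eU]].
  exact: back rc (span_uncovered _ _ _ rc eU).
Qed.

End MatroidCover.

(** * Degrees, edge deletion and edge contraction *)

Section Degrees.
Variable T : finType.
Implicit Types (e : rel T) (S : {set T}).

Definition nbrs e S x := [set y in S | e x y].
(** For a symmetric irreflexive [e], twice the number of edges inside [S]. *)
Definition arcs e S := \sum_(x in S) #|nbrs e S x|.

Lemma arcs_D1 e S x : symmetric e -> irreflexive e -> x \in S ->
  arcs e S = arcs e (S :\ x) + 2 * #|nbrs e S x|.
Proof.
move=> sym irr xS; rewrite /arcs (big_setD1 x) //=.
have -> : \sum_(y in S :\ x) #|nbrs e S y| =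
    \sum_(y in S :\ x) #|nbrs e (S :\ x) y| + \sum_(y in S :\ x) e x y.
  rewrite -big_split; apply: eq_bigr => y; rewrite !inE => /andP[yx yS] /=.
  rewrite (cardsD1 x) addnC !inE xS sym; congr (_ + _).
  by apply: eq_card => z; rewrite !inE andbA.
have -> : \sum_(y in S :\ x) e x y = #|nbrs e S x|.
  rewrite -sum1_card big_mkcond [RHS]big_mkcond; apply: eq_bigr => y _.
  rewrite !inE; case: (eqVneq y x) => [->|_] /=; first by rewrite irr andbF.
  by case: (y \in S) => //=; case: e.
by lia.
Qed.

Lemma eq_arcs e e' S : {in S &, e =2 e'} -> arcs e S = arcs e' S.
Proof.
move=> ee; apply: eq_bigr => x xS; apply: eq_card => y; rewrite !inE.
by case yS: (y \in S) => //=; apply: ee.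
Qed.

Lemma nbrs_le e S x : irreflexive e -> x \in S -> #|nbrs e S x| < #|S|.
Proof.
move=> irr xS; apply: proper_card; apply/properP; split.
  by apply/subsetP=> y; rewrite inE => /andP[].
by exists x => //; rewrite inE irr andbF.
Qed.

Lemma arcs_le e S : irreflexive e -> arcs e S <= #|S| * #|S|.-1.
Proof.
move=> irr; rewrite -sum_nat_const; apply: leq_sum => x xS.
by have := nbrs_le irr xS; case: #|S|.
Qed.

Definition del_edge e u v : rel T :=
  fun x y => e x y && ([set x; y] != [set u; v]).

Lemma del_edge_sym e u v : symmetric e -> symmetric (del_edge e u v).
Proof. by move=> sym x y; rewrite /del_edge sym setUC. Qed.

Lemma set2_eq (x y u v : T) : ([set x; y] == [set u; v]) =
  (x == u) && (y == v) || (x == v) && (y == u).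
Proof.
apply/eqP/idP=> [/setP E|/orP[/andP[/eqP-> /eqP->]|/andP[/eqP-> /eqP->]]] //; last exact: setUC.
move: (E x) (E y) (E u) (E v); rewrite !inE !eqxx ?orbT (eq_sym u x) (eq_sym u y) (eq_sym v x) (eq_sym v y).
by case: (x == u) (x == v) (y == u) (y == v) => [] [] [] [].
Qed.

Lemma arcs_del_edge e S u v : symmetric e -> irreflexive e -> u \in S -> v \in S ->
  e u v -> arcs e S = arcs (del_edge e u v) S + 2.
Proof.
move=> sym irr uS vS euv.
have uv : u != v by apply: contraTneq euv => ->; rewrite irr.
have -> : 2 = \sum_(x in S) ((x == u) + (x == v)).
  rewrite big_split /= (bigD1 u) //= eqxx (bigD1 v vS) //= eqxx !big1 // => x /andP[_].
    by move/negbTE->.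
  by move/negbTE->.
rewrite /arcs -big_split; apply: eq_bigr => x xS /=.
have [->|xu] := eqVneq x u.
  rewrite (negbTE uv) (cardsD1 v) inE vS euv addnC; congr (_ + _).
  apply: eq_card => y; rewrite !inE /del_edge set2_eq eqxx (negbTE uv) /= orbF.
  by case: (y \in S) (e u y) => [] [] //=; rewrite ?andbT ?andbF.
have [->|xv] := eqVneq x v.
  rewrite (cardsD1 u) inE uS sym euv addnC; congr (_ + _).
  apply: eq_card => y; rewrite !inE /del_edge set2_eq eqxx (eq_sym v u) (negbTE uv) /=.
  by case: (y \in S) (e v y) => [] [] //=; rewrite ?andbT ?andbF.
rewrite addn0; apply: eq_card => y; rewrite !inE /del_edge set2_eq (negbTE xu) (negbTE xv) /=.
by rewrite andbT.
Qed.

(** The edge [x y] is contracted onto [x]; [y] stays in the type as an isolated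
    vertex, so that minors of a graph live on the same type. *)
Definition contract e x y : rel T := fun u v =>
  [&& u != y, v != y, u != v & [|| e u v, (u == x) && e y v | (v == x) && e u y]].

Lemma contract_sym e x y : symmetric e -> symmetric (contract e x y).
Proof.
move=> sym u v; rewrite /contract (sym v u) (sym v y) (sym y u) (eq_sym v u).
by rewrite andbCA [_ && e u y || _]orbC.
Qed.

Lemma contract_irrefl e x y : irreflexive (contract e x y).
Proof. by move=> u; rewrite /contract eqxx /= !andbF. Qed.

(** Contracting [x y] loses this edge and merges the two other edges of each
    triangle on it. *)
Lemma arcs_contract e S x y : symmetric e -> irreflexive e -> x \in S -> y \in S -> e x y ->
  arcs e S = arcs (contract e x y) (S :\ y) + 2 * #|nbrs e S x :&: nbrs e S y| + 2.
Proof.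
move=> sym irr xS yS exy.
have xy : x != y by apply: contraTneq exy => ->; rewrite irr.
have xSy : x \in S :\ y by rewrite !inE xy.
rewrite (arcs_D1 sym irr yS) (arcs_D1 sym irr xSy).
rewrite (arcs_D1 (contract_sym _ _ sym) (contract_irrefl _ _ _) xSy).
rewrite (@eq_arcs (contract e x y) e); last first.
  move=> u v; rewrite !inE => /and3P[ux uy uS] /and3P[vx vy vS].
  rewrite /contract uy vy (negbTE ux) (negbTE vx) /= orbF.
  by case: eqVneq => // ->; rewrite irr.
have -> : nbrs (contract e x y) (S :\ y) x = nbrs e (S :\ y) x :|: (nbrs e S y :\ x).
  apply/setP=> z; rewrite !inE /contract xy eqxx /=.
  case: (eqVneq z x) => [->|zx] /=; first by rewrite ?irr ?andbF.
  case: (eqVneq z y) => [->|] //=; first by rewrite ?irr ?andbF.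
  by case: (z \in S); rewrite ?andbF ?orbF ?andbT.
rewrite (cardsD1 x (nbrs e S y)) inE xS sym exy.
have := cardsUI (nbrs e (S :\ y) x) (nbrs e S y :\ x).
have -> : nbrs e (S :\ y) x :&: (nbrs e S y :\ x) = nbrs e S x :&: nbrs e S y.
  apply/setP=> z; rewrite !inE.
  case: (eqVneq z x) => [->|zx] /=; first by rewrite irr !andbF.
  by case: (eqVneq z y) => [->|] //=; rewrite irr !andbF.
by lia.
Qed.

Lemma arcs_card e S :
  arcs e S = #|[set p : T * T | [&& p.1 \in S, p.2 \in S & e p.1 p.2]]|.
Proof.
rewrite -sum1_card (eq_bigl (fun p : T * T => (p.1 \in S) && ((p.2 \in S) && e p.1 p.2))); last first.
  by move=> p; rewrite inE.
rewrite -(pair_big_dep (fun x => x \in S) (fun x y => (y \in S) && e x y) (fun _ _ => 1)) /=.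
by apply: eq_bigr => x _; rewrite -sum1_card; apply: eq_bigl => y; rewrite inE.
Qed.

End Degrees.

Section EdgeSets.
Variable G : sgraph.

Definition edges : {set {set G}} := [set [set p.1; p.2] | p in [set p : G * G | adj p.1 p.2]].
Definition edges_in (S : {set G}) := [set e in edges | e \subset S].

Lemma edgeP (e : {set G}) : reflect (exists x y : G, adj x y /\ e = [set x; y]) (e \in edges).
Proof.
apply: (iffP imsetP) => [[[x y]] | [x [y [xy ->]]]].
  by rewrite inE /= => xy ->; exists x, y.
by exists (x, y); rewrite ?inE.
Qed.

Lemma edge_in (x y : G) : ([set x; y] \in edges) = adj x y.
Proof.
apply/edgeP/idP => [[u [v [uv /eqP]]] | xy]; last by exists x, y.
by rewrite set2_eq => /orP[/andP[/eqP-> /eqP->] | /andP[/eqP-> /eqP->]] //; rewrite adj_sym.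
Qed.

Lemma set2_sub (x y : G) (S : {set G}) : ([set x; y] \subset S) = (x \in S) && (y \in S).
Proof. by rewrite subUset !sub1set. Qed.

Lemma edges_in_arcs (S : {set G}) : 2 * #|edges_in S| <= arcs (@adj G) S.
Proof.
rewrite arcs_card -[X in _ <= X]sum1_card.
rewrite (partition_big (fun p => [set p.1; p.2]) (fun e => e \in edges_in S)) /=.
  rewrite mulnC -sum_nat_const; apply: leq_sum => e; rewrite inE => /andP[/edgeP[x [y [xy ->]]]].
  rewrite set2_sub => /andP[xS yS]; rewrite sum1_card.
  have -> : 2 = #|[set (x, y); (y, x)]|.
    by rewrite cards2 xpair_eqE; case: (eqVneq x y) xy => // ->; rewrite adj_irrefl.
  apply: subset_leq_card; apply/subsetP => p.
  rewrite !inE unfold_in inE => /orP[] /eqP-> /=; first by rewrite xS yS xy eqxx.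
  by rewrite xS yS adj_sym xy setUC eqxx.
by move=> p; rewrite !inE edge_in set2_sub => /and3P[-> -> ->].
Qed.

End EdgeSets.

(** * Decomposing sparse graphs into pseudoforests *)

Section CycleSteps.
Variables (T : finType) (p : seq T).
Hypothesis up : uniq p.

Lemma next_closed (P : pred T) x : (forall y, y \in p -> P y -> P (next p y)) ->
  x \in p -> P x -> {in p, forall y, P y}.
Proof.
move=> cl xp Px y; rewrite -(fconnect_cycle (cycle_next up) xp) => /iter_findex <-.
suff : forall n, (iter n (next p) x \in p) && P (iter n (next p) x).
  by move/(_ (findex (next p) x y)) => /andP[].
by elim=> [|n /andP[np Pn]] /=; rewrite ?xp // mem_next np cl.
Qed.

Lemma prev_closed (P : pred T) x : (forall y, y \in p -> P y -> P (prev p y)) ->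
  x \in p -> P x -> {in p, forall y, P y}.
Proof.
move=> cl xp Px y yp; apply/negPn/negP => nPy; suff : ~~ P x by rewrite Px.
apply: (@next_closed (predC P) y) => // z zp /=; apply: contra => Pz.
by rewrite -(prev_next up z) cl // mem_next.
Qed.

Lemma next_next_neq x : 2 < size p -> x \in p -> next p (next p x) != x.
Proof.
move=> p3 xp; have [i s def_s] := rot_to xp.
rewrite -!(next_rot i up) def_s; move: up; rewrite -(rot_uniq i) def_s.
have : 2 < size (x :: s) by rewrite -def_s size_rot.
case: s {def_s} => [|a [|b s]] //= _.
rewrite !inE !negb_or => /and3P[/and3P[xa xb _] /andP[ab _] _].
by rewrite eqxx (eq_sym a x) (negbTE xa) eqxx eq_sym.
Qed.

End CycleSteps.

(** A choice of an owner among the two ends of each edge, such that no vertex owns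
    two edges, amounts to an orientation with out-degrees at most one. *)
Section Owners.
Variables (G : sgraph) (o : {set G} -> G).
Hypothesis own_in : forall x y : G, adj x y -> o [set x; y] \in [set x; y].
Hypothesis own_inj : forall x y z w : G, adj x y -> adj z w ->
  o [set x; y] = o [set z; w] -> [set x; y] = [set z; w].

Lemma out_unique (x y z : G) : adj x y -> adj x z ->
  o [set x; y] = x -> o [set x; z] = x -> y = z.
Proof.
move=> xy xz oy oz; have /eqP := own_inj xy xz (etrans oy (esym oz)).
by rewrite set2_eq eqxx /= => /orP[/eqP|/andP[/eqP <- /eqP]].
Qed.

(** A cycle has as many edges as vertices, so each vertex owns one of its edges:
    if [x] does not own the edge to [next p x], then [next p x] owns it and
    cannot own the following edge too. All edges are thus directed the same way,
    and following them from one vertex visits the whole cycle. *)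
Lemma cycle_out (p : seq G) : is_cycle p -> exists h : G -> G,
  [/\ {in p, forall x, [/\ h x \in p, adj x (h x) & o [set x; h x] = x]},
      forall (P : pred G) x, (forall y, y \in p -> P y -> P (h y)) ->
        x \in p -> P x -> {in p, forall y, P y} &
      cycle_edges p = [set [set x; h x] | x in p]].
Proof.
case/and3P=> p3 up cp.
have adjn x : x \in p -> adj x (next p x) by exact: next_cycle.
have [/allP all_self | /allPn[x0 x0p nx0]] :=
    boolP (all (fun x => o [set x; next p x] == x) p).
  exists (next p); split=> // [x xp | P x]; last exact: next_closed.
  by rewrite mem_next xp; split=> //; [exact: adjn | apply/eqP/all_self].
have own2 x : x \in p -> o [set x; next p x] != x -> o [set x; next p x] = next p x.
  by move=> xp nx; have := own_in (adjn x xp); rewrite !inE (negbTE nx) => /eqP.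
have all_next : {in p, forall x, o [set x; next p x] != x}.
  apply: (next_closed up _ x0p nx0) => x xp nx; apply/negP => /eqP ox.
  have np : next p x \in p by rewrite mem_next.
  have /eqP := own_inj (adjn x xp) (adjn _ np) (etrans (own2 x xp nx) (esym ox)).
  have := next_next_neq up p3 xp; set y := next p x => nyx.
  rewrite set2_eq eqxx andbT (eq_sym x (next p y)) (negbTE nyx) orbF => /andP[/eqP xy /eqP yy].
  by rewrite -yy -xy eqxx in nyx.
exists (prev p); split=> [x xp | P x | ].
- have pp : prev p x \in p by rewrite mem_prev.
  have := own2 _ pp (all_next _ pp); rewrite next_prev // setUC => ->.
  by rewrite pp adj_sym; have := adjn _ pp; rewrite next_prev.
- exact: prev_closed.
- apply/setP=> e; apply/imsetP/imsetP => -[x xp ->].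
    by exists (next p x); rewrite ?mem_next // prev_next // setUC.
  by exists (prev p x); rewrite ?mem_prev // next_prev // setUC.
Qed.

(** Following owned edges from a vertex of a component leads to every cycle of
    that component, as this holds at the cycle and passes to adjacent vertices;
    a vertex on a cycle never leaves it. Two cycles of a component thus share a
    vertex, and then all the edges that are followed from there. *)
Lemma owned_pseudoforest : pseudoforest G.
Proof.
move=> p q cp cq [x0 [y0 [x0p y0q con]]].
have [h [hp clp ->]] := cycle_out cp; have [g [gq clq ->]] := cycle_out cq.
pose out x y := adj x y && (o [set x; y] == x).
have out_p x y : x \in p -> out x y -> y \in p.
  move=> xp /andP[xy /eqP oy]; have [hxp xh ox] := hp x xp.
  by rewrite (out_unique xy xh oy ox).
have out_q x y : x \in q -> out x y -> y \in q.
  move=> xq /andP[xy /eqP oy]; have [hxq xh ox] := gq x xq.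
  by rewrite (out_unique xy xh oy ox).
(* Following owned edges from [y0] ends in the cycle [p]. *)
have [z zp zc] : exists2 z, z \in p & connect out y0 z.
  case/connectP: con => s; elim/last_ind: s y0 {y0q} => [|s y IH] y0 /=.
    by move=> _ ->; exists x0; rewrite ?connect0.
  rewrite rcons_path last_rcons => /andP[ps uy] -> {y0}.
  have [z zp zc] := IH _ ps erefl; set u := last x0 s in uy zc.
  have := own_in uy; rewrite !inE => /orP[] /eqP oe; last first.
    exists z => //; apply: connect_trans zc; apply: connect1.
    by rewrite /out adj_sym uy setUC oe eqxx.
  have uy' : out u y by rewrite /out uy oe eqxx.
  case/connectP: zc => [[|v s']] /=.
    by move=> _ zu; exists y; rewrite ?connect0 // (out_p u) // -zu.
  case/andP=> /andP[uv /eqP ov] ps' zl; exists z => //.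
  by apply/connectP; exists s'; rewrite (out_unique uy uv oe ov).
have zq : z \in q.
  case/connectP: zc => s; elim: s y0 y0q {con} => [|y s IH] y0 y0q /=; first by move=> _ ->.
  by case/andP=> oy; apply: IH; apply: out_q oy.
have agree x : x \in p -> x \in q -> h x = g x.
  by move=> /hp[_ xh ox] /gq[_ xg ox']; exact: out_unique ox ox'.
have pq : {in p, forall x, x \in q}.
  by apply: (clp (mem q) z) => // y yp yq; rewrite (agree y) //; have [] := gq y yq.
have qp : {in q, forall x, x \in p}.
  by apply: (clq (mem p) z) => // y yq yp; rewrite -(agree y) //; have [] := hp y yp.
apply/setP=> e; apply/imsetP/imsetP => -[x xin ->].
  by exists x; rewrite ?(agree x) ?pq.
by exists x; rewrite -?(agree x) ?qp.
Qed.

End Owners.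

Section Orientation.
Variables (T : finType) (d : nat).

(** The closure of the uniform matroid of rank [d] on the edges at [v], all other
    edges being loops: its independent sets are the sets of at most [d] edges
    at [v]. *)
Definition star_span (v : T) (A : {set {set T}}) (e : {set T}) :=
  [|| v \notin e, e \in A | d <= #|[set f in A | v \in f]|].

Lemma star_matroid v : closure_matroid (star_span v).
Proof.
pose star (A : {set {set T}}) := [set f in A | v \in f].
split=> [A e eA | A B e sAB | A e f].
- by rewrite /star_span eA orbT.
- case: (leqP d #|star A|) => dA.
    by rewrite /star_span dA !orbT.
  case/or3P => [nve | /sAB // | dB]; first by rewrite /star_span nve.
  have : #|star B| <= #|star A|.
    apply: subset_leq_card; apply/subsetP=> x; rewrite !inE => /andP[xB vx].
    rewrite vx andbT; case/or3P: (sAB x xB) => //; first by rewrite vx.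
    by rewrite leqNgt dA.
  by move=> /(leq_trans dB); rewrite leqNgt dA.
- rewrite /star_span !negb_or negbK -ltnNge => + /and3P[vf fA dA].
  rewrite vf /= in_setU1 (negbTE fA) orbF.
  case/orP => [/eqP-> | d1]; first by rewrite setU11 orbT.
  apply/or3P; case: (boolP (v \in e)) => ve; last by constructor 1.
  constructor 3; apply: leq_trans d1 _; rewrite -/(star A) in dA *.
  have -> : [set x in (f |: A) | v \in x] = f |: star A.
    by apply/setP=> x; rewrite !inE; case: eqP => // ->; rewrite vf.
  have -> : [set x in (e |: A) | v \in x] = e |: star A.
    by apply/setP=> x; rewrite !inE; case: eqP => // ->; rewrite ve.
  by rewrite !cardsU1 [f \in _]inE (negbTE fA) /= leq_add2r leq_b1.
Qed.

End Orientation.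

(** Hakimi's orientation theorem. If the partition into independent sets of the
    star matroids fails, let [W] be the set of vertices that own at least [d]
    edges of the obstruction [D]. A vertex outside [W] owns all edges of [D]
    that contain it, so the edges of [D] owned by vertices of [W], and the edge
    without owner, lie inside [W]: these are more than [d * #|W|] edges. *)
Lemma bounded_ownership (G : sgraph) (d : nat) :
  (forall S : {set G}, arcs (@adj G) S <= 2 * d * #|S|) ->
  exists c : {ffun {set G} -> option G},
    (forall e, e \in edges G -> exists2 v, c e = Some v & v \in e) /\
    forall v, #|colour_class (edges G) c v| <= d.
Proof.
move=> sparse.
case: (matroid_cover (@star_matroid G d) (edges G)) => [[c vc cov] | [c [e0 [D [DX e0D ce0 spD]]]]].
  exists c; have indc v e : e \in colour_class (edges G) c v ->
      v \in e /\ #|[set f in colour_class (edges G) c v :\ e | v \in f]| < d.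
    move=> ecl; have /indepP/(_ e ecl) := forallP vc v.
    by rewrite /star_span !negb_or negbK -ltnNge => /and3P[].
  split=> [e eX | v].
    case ce: (c e) => [v|]; last by have := in_set0 e; rewrite -cov inE eX ce.
    by exists v => //; have [] := indc v e _; rewrite // inE eX ce eqxx.
  have [-> | [e ecl]] := set_0Vmem (colour_class (edges G) c v); first by rewrite cards0.
  have [_] := indc v e ecl; rewrite (cardsD1 e (colour_class (edges G) c v)) ecl; congr (_ < _).
  apply: eq_card => f; rewrite inE andb_idr // !inE => /andP[_ fc].
  by have [|//] := indc v f; rewrite inE.
exfalso; pose A v := colour_class (edges G) c v :&: D.
pose W := [set v | d <= #|[set f in A v | v \in f]|].
pose D' := [set e in D | if c e is Some i then i \in W else false].
have e0D' : e0 \notin D' by rewrite inE ce0 andbF.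
have inW e : e \in e0 |: D' -> e \in edges_in W.
  move=> eD'; have eD : e \in D.
    by move: eD'; rewrite !inE => /predU1P[-> // | /andP[]].
  rewrite inE (subsetP DX e eD); apply/subsetP => v ve; rewrite inE.
  case/or3P: (spD v e eD) => //; first by rewrite ve.
  rewrite inE inE => /andP[/andP[_ /eqP ce] _].
  by move: eD'; rewrite !inE; case/predU1P => [ee0|]; [rewrite ee0 ce0 in ce | rewrite ce inE => /andP[]].
have := subset_leq_card (introT subsetP inW); rewrite cardsU1 e0D' /=.
have : \sum_(i in W) #|A i| = #|D'| := sum_colour_class c W DX.
have : d * #|W| <= \sum_(i in W) #|A i|.
  rewrite mulnC -sum_nat_const; apply: leq_sum => v; rewrite inE => /leq_trans -> //.
  by apply: subset_leq_card; apply/subsetP => e; rewrite inE => /andP[].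
have := edges_in_arcs W; have := sparse W; rewrite -mulnA.
clearbody W D'; move: (\sum_(i in W) _) (d * #|W|) #|D'| (arcs _ W) #|edges_in W| => a b x y z; lia.
Qed.

(** Each vertex numbers the edges that it owns; the number is the colour. *)
Lemma sparse_pseudoforests (G : sgraph) (d : nat) : 0 < d ->
  (forall S : {set G}, arcs (@adj G) S <= 2 * d * #|S|) -> decomposes pseudoforest G d.
Proof.
case: d => // d _ /bounded_ownership[c [own bound]].
pose rank e := if c e is Some v then index e (enum (colour_class (edges G) c v)) else 0.
exists (fun e => inord (rank e)) => i p q.
case: p => [|x0 p] // cp cq.
have rank_lt e v : e \in edges G -> c e = Some v -> rank e < d.+1.
  move=> eX ce; rewrite /rank ce; apply: leq_trans (bound v); rewrite cardE index_mem.
  by rewrite mem_enum inE eX ce eqxx.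
apply: (@owned_pseudoforest (color_class _ i) (fun e => odflt x0 (c e)) _ _ (x0 :: p) q cp cq).
  move=> x y /andP[xy _].
  by have [v ->] := own _ (etrans (@edge_in G x y) xy).
move=> x y z w /andP[xy /eqP cxy] /andP[zw /eqP czw].
have xyE := etrans (@edge_in G x y) xy.
have zwE := etrans (@edge_in G z w) zw.
have [v cv _] := own _ xyE; have [u cu _] := own _ zwE.
rewrite cv cu /= => vu; move: cu; rewrite -vu => cu.
have : rank [set x; y] = rank [set z; w].
  have := congr1 val (etrans cxy (esym czw)).
  by rewrite /= !inordK // (rank_lt _ v).
rewrite /rank cv cu => /(congr1 (nth set0 (enum (colour_class (edges G) c v)))).
by rewrite !nth_index // mem_enum inE ?xyE ?zwE ?cv ?cu eqxx.
Qed.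

(** * Decomposing sparse graphs into forests *)

Section GraphicMatroid.
Variable T : finType.
Implicit Types (A B : {set {set T}}) (e f : {set T}).

Definition link A : rel T := fun x y => [set x; y] \in A.

Lemma link_sym A : symmetric (link A).
Proof. by move=> x y; rewrite /link setUC. Qed.

Lemma link_connect_sym A : connect_sym (link A).
Proof. exact/sym_connect_sym/link_sym. Qed.

Lemma connect_linkS A B : A \subset B -> subrel (connect (link A)) (connect (link B)).
Proof. by move=> AB; apply: connect_sub => x y xy; apply/connect1/(subsetP AB). Qed.

(** The closure of the graphic matroid: an edge is spanned when its ends are
    connected. Sets that are not of the form [[set x; y]] are loops. *)
Definition graph_span A e :=
  [forall x, forall y, (e == [set x; y]) ==> connect (link A) x y].

Lemma graph_spanP A e :
  reflect (forall x y, e = [set x; y] -> connect (link A) x y) (graph_span A e).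
Proof.
apply: (iffP forallP) => [h x y /eqP exy | h x]; first by have /forallP/(_ y)/implyP := h x; apply.
by apply/forallP=> y; apply/implyP=> /eqP; apply: h.
Qed.

Lemma graph_span_set2 A x y : graph_span A [set x; y] = connect (link A) x y.
Proof.
apply/graph_spanP/idP => [|xy u v /eqP]; first exact.
rewrite set2_eq => /orP[] /andP[/eqP<- /eqP<-] //.
by rewrite link_connect_sym.
Qed.

Lemma connect_linkU1 A u v x y : connect (link ([set u; v] |: A)) x y ->
  [\/ connect (link A) x y,
      connect (link A) x u /\ connect (link A) v y |
      connect (link A) x v /\ connect (link A) u y].
Proof.
case/connectP=> s; elim/last_ind: s y => [|s z IH] y /=.
  by move=> _ ->; constructor 1.
rewrite rcons_path last_rcons => /andP[ps wz] -> {y}.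
have := IH _ ps erefl; move: (last x s) wz => w.
rewrite /link in_setU1 set2_eq => /orP[|wz]; last first.
  have wz' : connect (link A) w z by apply: connect1.
  by case=> [h | [h1 h2] | [h1 h2]]; 
      [constructor 1 | constructor 2; split=> // | constructor 3; split=> //];
    apply: connect_trans wz'.
case/orP=> /andP[/eqP-> /eqP->].
  by case=> [h | [h1 h2] | [h1 h2]]; [constructor 2 | constructor 2 | constructor 1].
by case=> [h | [h1 h2] | [h1 h2]]; [constructor 3 | constructor 1 | constructor 3].
Qed.

Lemma graphic_matroid : closure_matroid graph_span.
Proof.
split=> [A e eA | A B e AB | A e f].
- by apply/graph_spanP=> x y exy; apply: connect1; rewrite /link -exy.
- move/graph_spanP=> Be; apply/graph_spanP=> x y /Be; apply: connect_sub => u v /AB.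
  by rewrite graph_span_set2.
- move=> /graph_spanP ef nf; apply/graph_spanP=> u v euv.
  have [x [y [fxy nxy]]] : exists x y, f = [set x; y] /\ ~~ connect (link A) x y.
    move: nf; rewrite negb_forall => /existsP[x]; rewrite negb_forall => /existsP[y].
    by rewrite negb_imply => /andP[/eqP-> nxy]; exists x, y.
  have AfA : subrel (connect (link A)) (connect (link (f |: A))) by apply/connect_linkS/subsetUr.
  have fA : connect (link (f |: A)) x y by apply: connect1; rewrite /link -fxy setU11.
  have := ef x y fxy; rewrite euv => /connect_linkU1[h | [xu vy] | [xv uy]].
  + by rewrite h in nxy.
  + apply: connect_trans (AfA u x _) _; first by rewrite link_connect_sym.
    apply: connect_trans fA _; rewrite link_connect_sym; exact: AfA.
  + apply: connect_trans (AfA u y uy) _; rewrite link_connect_sym in fA.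
    exact: connect_trans fA (AfA _ _ xv).
Qed.

(** A connected graph on [W] has at least [#|W| - 1] edges: grow a set [S] from
    [u] by one vertex at a time, through an edge that leaves [S]. *)
Lemma connected_edges A (W : {set T}) u : u \in W ->
  (forall x y, x \in W -> link A x y -> y \in W) ->
  (forall x, x \in W -> connect (link A) u x) ->
  #|W|.-1 <= #|[set e in A | e \subset W]|.
Proof.
move=> uW closedW conn.
suff grow n : n < #|W| -> exists S : {set T}, [/\ u \in S, S \subset W, #|S| = n.+1 &
    n <= #|[set e in A | e \subset S]|].
  have W0 : 0 < #|W| by apply/card_gt0P; exists u.
  have [|S [_ SW cS]] := grow #|W|.-1; first by rewrite prednK.
  by move/eqP: SW => /= SW; have /eqP -> : S == W by rewrite eqEcard cS prednK // leqnn andbT; apply/eqP.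
elim: n => [_|n IH nW]; first by exists [set u]; rewrite sub1set set11 cards1.
have [S [uS SW cS edS]] := IH (ltnW nW).
have [w wW wS] : exists2 w, w \in W & w \notin S.
  by apply/subsetPn; apply: contraL nW => /subset_leq_card; rewrite cS -leqNgt.
have [a [b [aS bS ab]]] : exists a b, [/\ a \in S, b \notin S & link A a b].
  have [s us ws] := connectP (conn w wW); rewrite {}ws {wW} in wS.
  elim: s (u) uS us wS => [|b s IHs] a aS /=; first by rewrite aS.
  case/andP=> ab; case: (boolP (b \in S)) => bS; first exact: IHs.
  by exists a, b.
exists (b |: S); split.
- by rewrite in_setU1 uS orbT.
- by rewrite subUset SW sub1set (closedW a) // (subsetP SW).
- by rewrite cardsU1 bS cS.
- apply: leq_ltn_trans edS _; apply: proper_card; apply/properP; split.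
    apply/subsetP=> e; rewrite !inE => /andP[-> /= eS].
    exact: subset_trans eS (subsetUr _ _).
  exists [set a; b]; rewrite !inE -/(link A a b) ab /= subUset !sub1set ?in_setU1 ?aS ?eqxx ?orbT //.
Qed.

End GraphicMatroid.

Section NashWilliams.
Variable G : sgraph.

(** A cycle leaves each of its edges spanned by the others. *)
Lemma indep_forest (A : {set {set G}}) (F : sgraph) (h : F -> G) : injective h ->
  (forall x y : F, adj x y -> [set h x; h y] \in A) ->
  indep (@graph_span G) A -> forest F.
Proof.
move=> hinj FA /indepP iA [|x s]; first by [].
apply/negP => /and3P[p3 up cp]; set p := x :: s in p3 up cp.
have xp : x \in p by rewrite mem_head.
set a := next p x; have ap : a \in p by rewrite mem_next.
have xa : adj x a := next_cycle cp xp.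
have := iA _ (FA x a xa); rewrite graph_span_set2 => /negP; apply.
rewrite link_connect_sym; set L := link _.
pose P z := connect L (h a) (h x) || connect L (h a) (h z).
have : P x; last by rewrite /P orbb.
have Pa : P a by rewrite /P connect0 orbT.
apply: (@next_closed _ p up P a _ ap Pa x xp) => z zp; rewrite /P.
case/orP=> [-> // | az]; have [<- | zx] := eqVneq z x; first by rewrite az.
apply/orP; right; apply: connect_trans az _; apply: connect1.
rewrite /L /link in_setD1 FA ?andbT; last exact: next_cycle.
rewrite set2_eq !(inj_eq hinj) (negbTE zx) /=; apply/negP => /andP[/eqP za].
by rewrite za (negbTE (next_next_neq up p3 xp)).
Qed.

(** If the partition into [t] forests fails, take a component [W] of the
    obstruction [D] around the uncoloured edge [e0]. Each class restricted to [D]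
    connects [W], so it has at least [#|W| - 1] edges inside [W], and [e0] is one
    more edge inside [W]. *)
Lemma nash_williams (t : nat) : 0 < t ->
  (forall W : {set G}, 1 < #|W| -> #|edges_in W| <= t * #|W|.-1) -> decomposes forest G t.
Proof.
case: t => // t _ sparse.
case: (matroid_cover (fun i : 'I_t.+1 => graphic_matroid G) (edges G)) =>
  [[c vc cov] | [c [e0 [D [DX e0D ce0 spD]]]]].
  exists (fun e => odflt ord0 (c e)) => i.
  apply: (@indep_forest (colour_class (edges G) c i) (color_class _ i) id) => //; last exact: (forallP vc).
  move=> x y /andP[xy /eqP ci]; have xyE := etrans (@edge_in G x y) xy.
  rewrite inE xyE -ci /=; case ce: (c _) => [j|] //=.
  by have := in_set0 [set (x : G); y]; rewrite -cov inE xyE ce.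
exfalso; have /edgeP[u [v [uv e0E]]] := subsetP DX e0 e0D.
pose W := [set x | connect (link D) u x].
pose DW := [set e in D | e \subset W].
have uW : u \in W by rewrite inE connect0.
have closedW x y : x \in W -> link D x y -> y \in W.
  by rewrite !inE => ux xy; apply: connect_trans ux (connect1 xy).
have vW : v \in W by apply: (closedW u) => //; rewrite /link -e0E.
have e0DW : e0 \in DW by rewrite inE e0D e0E set2_sub uW.
have W2 : 1 < #|W|.
  rewrite (cardsD1 u) uW (cardsD1 v) !inE; rewrite inE in vW; rewrite vW.
  by case: (eqVneq v u) uv => // ->; rewrite adj_irrefl.
have DWX : DW \subset edges G.
  by apply/subsetP=> e; rewrite inE => /andP[/(subsetP DX)].
have cl i : #|W|.-1 <= #|colour_class (edges G) c i :&: DW|.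
  have -> : colour_class (edges G) c i :&: DW = [set e in colour_class (edges G) c i :&: D | e \subset W].
    by apply/setP=> e; rewrite !inE andbA.
  apply: (@connected_edges _ _ W u uW) => [x y xW xy | x].
    by apply: closedW xW _; move: xy; rewrite /link inE => /andP[].
  rewrite inE; apply: connect_sub => y z yz.
  by rewrite -graph_span_set2; apply: spD.
have := sum_colour_class c [set: 'I_t.+1] DWX.
set C := [set e in DW | _] => sumC.
have : #|e0 |: C| <= #|edges_in W|.
  apply/subset_leq_card/subsetP => e; rewrite in_setU1 => eC.
  have : e \in DW by case/predU1P: eC => [-> // |]; rewrite inE => /andP[].
  by rewrite inE => /andP[eD eW]; rewrite inE (subsetP DX).
rewrite cardsU1 [e0 \in C]inE ce0 andbF -sumC; apply/negP; rewrite -ltnNge.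
apply: leq_ltn_trans (sparse W W2) _; rewrite add1n ltnS.
have -> : t.+1 * #|W|.-1 = \sum_(i in [set: 'I_t.+1]) #|W|.-1.
  by rewrite sum_nat_const cardsT card_ord.
by apply: leq_sum => i _; apply: cl.
Qed.

End NashWilliams.

(** * Disjoint arcs cross evenly *)

Section Winding.
Variable R : realType.
Implicit Types u v w q : (R * R)%type.
Local Open Scope ring_scope.

(** The open upper half-plane with the positive half-axis. Of two opposite nonzero
    vectors, exactly one is in it. *)
Definition upper u := (0 < u.2) || ((u.2 == 0) && (0 < u.1)).
Definition det2 u v := u.1 * v.2 - u.2 * v.1.
Definition dot2 u v := u.1 * v.1 + u.2 * v.2.

(** Whether the segment from [u] to [v] crosses the positive half-axis, provided
    that [u] and [v] lie in an open half-plane bounded by a line through 0; this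
    proviso takes the form [0 < dot2 q u] and [0 < dot2 q v] below. *)
Definition crosses_ray u v := (upper u (+) upper v) && (upper u == (det2 u v < 0)).

Lemma upperN u : u != 0 -> upper (- u) = ~~ upper u.
Proof.
case: u => x y; rewrite /upper /= oppr_gt0 oppr_eq0 oppr_gt0 xpair_eqE negb_and.
by case: ltrgt0P => //= _; case: ltrgt0P.
Qed.

Lemma upper_cone u v (a b : R) : 0 <= a -> 0 < b -> upper u -> upper v ->
  upper (a * u.1 + b * v.1, a * u.2 + b * v.2).
Proof.
case: u v => [x y] [z t]; rewrite /upper /= => a0 b0.
case/orP=> [y0 | /andP[/eqP-> x0]]; case/orP => [t0 | /andP[/eqP-> z0]].
- by apply/orP; left; nra.
- move: a0; rewrite le_eqVlt => /predU1P[<- | a0].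
    by apply/orP; right; rewrite !mul0r mulr0 !add0r eqxx mulr_gt0.
  by apply/orP; left; nra.
- by apply/orP; left; nra.
- by apply/orP; right; rewrite !mulr0 addr0 eqxx /=; nra.
Qed.

Lemma upperZ u (a : R) : 0 < a -> upper (a * u.1, a * u.2) = upper u.
Proof.
by move=> a0; rewrite /upper /= !pmulr_rgt0 // mulf_eq0 (gt_eqF a0).
Qed.

Lemma dot2_neq0 q u : 0 < dot2 q u -> u != 0.
Proof. by apply: contraTneq => ->; rewrite /dot2 /= !mulr0 addr0 ltxx. Qed.

(** If [det2 v w] were nonnegative, the identity
    [det2 v w *: u - det2 u w *: v = - det2 u v *: w] would have nonnegative
    coefficients on the left, and pairing with [q] would make the coefficient of
    [w] positive: [w] would lie in the cone of [u] and [v], hence in the upper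
    half-plane. *)
Lemma det2_upper q u v w : 0 < dot2 q u -> 0 < dot2 q v -> 0 < dot2 q w ->
  upper u -> upper v -> ~~ upper w -> det2 u w < 0 -> det2 v w < 0.
Proof.
move=> qu qv qw Uu Uv Uw d1; apply: contraNT Uw; rewrite -leNgt => d2.
have t0 : 0 < - det2 u v.
  rewrite -(pmulr_lgt0 _ qw).
  have -> : - det2 u v * dot2 q w = det2 v w * dot2 q u - det2 u w * dot2 q v.
    by rewrite /det2 /dot2; ring.
  by nra.
rewrite -(upperZ _ t0).
have d1' : 0 < - det2 u w by rewrite oppr_gt0.
have := upper_cone d2 d1' Uu Uv.
by congr (upper (_, _)); rewrite /det2; ring.
Qed.

Lemma det2N u v : det2 (- u) (- v) = det2 u v.
Proof. by rewrite /det2 /=; ring. Qed.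

Lemma dot2NN u v : dot2 (- u) (- v) = dot2 u v.
Proof. by rewrite /dot2 /=; ring. Qed.

Lemma det2_lt0 q u v w : 0 < dot2 q u -> 0 < dot2 q v -> 0 < dot2 q w ->
  upper u = upper v -> upper w = ~~ upper u -> (det2 u w < 0) = (det2 v w < 0).
Proof.
move=> qu qv qw uv uw; case Uu: (upper u) uv uw => /esym Uv Uw.
  by apply/idP/idP; apply: (@det2_upper q) => //; rewrite Uw.
have [nu nv nw] : [/\ u != 0, v != 0 & w != 0] by split; apply: (@dot2_neq0 q).
rewrite -(det2N u) -(det2N v).
by apply/idP/idP; apply: (@det2_upper (- q)); rewrite ?dot2NN ?upperN ?Uu ?Uv ?Uw.
Qed.

Lemma det2_neq0 q u w : 0 < dot2 q u -> 0 < dot2 q w ->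
  upper w = ~~ upper u -> det2 u w != 0.
Proof.
move=> qu qw uw; apply/eqP=> d0.
have : dot2 q u * w.1 = dot2 q w * u.1 /\ dot2 q u * w.2 = dot2 q w * u.2.
  have e1 : dot2 q u * w.1 = dot2 q w * u.1 - q.2 * det2 u w by rewrite /det2 /dot2; ring.
  have e2 : dot2 q u * w.2 = dot2 q w * u.2 + q.1 * det2 u w by rewrite /det2 /dot2; ring.
  by rewrite e1 e2 d0; split; ring.
case=> e1 e2; have := upperZ w qu; rewrite e1 e2 upperZ // uw.
by case: upper.
Qed.

Lemma det2C u v : det2 v u = - det2 u v.
Proof. by rewrite /det2; ring. Qed.

Lemma crosses_ray_sym q u v : 0 < dot2 q u -> 0 < dot2 q v -> crosses_ray u v = crosses_ray v u.
Proof.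
move=> qu qv; rewrite /crosses_ray addbC.
case Uv: (upper v (+) upper u) => //=.
have uv : upper v = ~~ upper u by case: (upper v) (upper u) Uv => [] [].
have := det2_neq0 qu qv uv; rewrite (det2C u v) oppr_lt0 uv.
by case: ltrgt0P => // _ _; case: (upper u).
Qed.

(** The boundary of a triangle that misses 0 crosses a ray an even number of
    times. *)
Lemma crosses_ray_triangle q u v w : 0 < dot2 q u -> 0 < dot2 q v -> 0 < dot2 q w ->
  crosses_ray u v (+) crosses_ray v w = crosses_ray u w.
Proof.
move=> qu qv qw.
have [uv | uv] := eqVneq (upper u) (upper v).
  rewrite /crosses_ray uv addbb /=; case uw: (upper v (+) upper w) => //=.
  rewrite (@det2_lt0 q u v w) //.
  by rewrite uv; case: (upper v) (upper w) uw => [] [].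
have uv' : upper v = ~~ upper u by case: (upper v) (upper u) uv => [] [].
have [uw | uw] := eqVneq (upper u) (upper w).
  rewrite (crosses_ray_sym qv qw) /crosses_ray -uw addbb /= uv' (@det2_lt0 q w u v) ?uw ?addbb //.
  by rewrite uv' uw.
have vw : upper w = upper v by move: uv uw; case: (upper u) (upper v) (upper w) => [] [] [].
rewrite (crosses_ray_sym qu qv) (crosses_ray_sym qu qw) /crosses_ray vw addbb /= addbF.
rewrite (@det2_lt0 q v w u) ?vw //.
by rewrite uv' negbK.
Qed.

(** The segment from [u] to [v] changes half-planes when it crosses exactly one of
    the two half-axes, and its opposite crosses the positive half-axis where it
    crosses the negative one. *)
Lemma crosses_rayN u v : u != 0 -> v != 0 ->
  crosses_ray (- u) (- v) = crosses_ray u v (+) (upper u (+) upper v).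
Proof.
move=> nu nv; rewrite /crosses_ray !upperN // det2N addbN addNb negbK.
by case: (upper u) (upper v) (det2 u v < 0) => [] [] [].
Qed.

Lemma grid_telescope (m n : nat) (h v : nat -> nat -> bool) :
  (forall i j, (i < m)%N -> (j < n)%N -> h i j (+) v i.+1 j = v i j (+) h i j.+1) ->
  \big[addb/false]_(i < m) h i 0%N (+) \big[addb/false]_(j < n) v m j =
  \big[addb/false]_(j < n) v 0%N j (+) \big[addb/false]_(i < m) h i n.
Proof.
move=> sq; elim: n sq => [|n IH] sq; first by rewrite !big_ord0 addbF.
rewrite !big_ord_recr /= addbA {}IH; last by move=> i j im jn; apply: sq => //; apply: ltnW.
rewrite -!addbA; congr (_ (+) _).
elim: m sq => [|m IHm] sq; first by rewrite !big_ord0 addbF.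
rewrite !big_ord_recr /= -addbA sq // addbA IHm ?addbA //.
by move=> i j im jn; apply: sq => //; apply: ltnW.
Qed.

Lemma telescope_addb (n : nat) (f : nat -> bool) :
  \big[addb/false]_(i < n) (f i (+) f i.+1) = f 0%N (+) f n.
Proof.
elim: n => [|n IH]; first by rewrite big_ord0 addbb.
by rewrite big_ord_recr /= IH -addbA addKb.
Qed.

(** Parity of the number of times that the polygonal path [p 0], ..., [p N] crosses
    the horizontal ray to the right of [c]. *)
Definition winding (N : nat) (c : R * R) (p : nat -> R * R) :=
  \big[addb/false]_(i < N) crosses_ray (p i - c) (p i.+1 - c).

(** Sum the square identities of the grid [p i - q j]: only the boundary remains.
    Two opposite sides are the path [p] seen from the ends of [q]; the other two
    are the path [q] seen from the ends of [p], up to the central symmetry that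
    [crosses_rayN] accounts for. *)
Lemma winding_exchange (N : nat) (p q : nat -> R * R) :
  (forall i j, (i <= N)%N -> (j <= N)%N -> p i != q j) ->
  (forall i j i' j', (i < N)%N -> (j < N)%N -> (i <= i' <= i.+1)%N -> (j <= j' <= j.+1)%N ->
     0 < dot2 (p i - q j) (p i' - q j')) ->
  winding N (q 0%N) p (+) winding N (q N) p (+)
    (winding N (p 0%N) q (+) winding N (p N) q) =
  upper (q 0%N - p 0%N) (+) upper (q N - p 0%N) (+)
    (upper (q 0%N - p N) (+) upper (q N - p N)).
Proof.
move=> dis close.
pose F i j := p i - q j.
have side i : (i <= N)%N -> \big[addb/false]_(j < N) crosses_ray (F i j) (F i j.+1) =
    winding N (p i) q (+) (upper (q 0%N - p i) (+) upper (q N - p i)).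
  move=> iN; rewrite -(telescope_addb N (fun j => upper (q j - p i))) /winding.
  rewrite -big_split /=; apply: eq_bigr => j _.
  rewrite /F -(opprB (q j)) -(opprB (q j.+1)) crosses_rayN //.
    by rewrite subr_eq0 eq_sym dis // ltnW.
  by rewrite subr_eq0 eq_sym dis.
have sq i j : (i < N)%N -> (j < N)%N ->
    crosses_ray (F i j) (F i.+1 j) (+) crosses_ray (F i.+1 j) (F i.+1 j.+1) =
    crosses_ray (F i j) (F i j.+1) (+) crosses_ray (F i j.+1) (F i.+1 j.+1).
  move=> iN jN; have cl i' j' := close i j i' j' iN jN.
  rewrite (@crosses_ray_triangle (F i j)) ?(@crosses_ray_triangle (F i j)) //;
  by apply: cl; rewrite ?leqnn ?leqnSn.
have := @grid_telescope N N (fun i j => crosses_ray (F i j) (F i.+1 j))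
  (fun i j => crosses_ray (F i j) (F i j.+1)) sq.
rewrite /= !side // -/(winding N (q 0%N) p) -/(winding N (q N) p).
move: (winding N (q 0%N) p) (winding N (q N) p) (winding N (p 0%N) q) (winding N (p N) q).
move: (upper (q 0%N - p 0%N) (+) _) (upper (q 0%N - p N) (+) _).
by case=> [] [] [] [] [] [].
Qed.

End Winding.

Section FineGrid.
Variable R : realType.
Local Open Scope classical_set_scope.
Local Open Scope ring_scope.

Lemma dot2_near (u v w : R * R) :
  `|v - u| < `|u| / 4 -> `|w - u| < `|u| / 4 -> 0 < dot2 v w.
Proof.
case: u v w => [x y] [a b] [c d].
rewrite !prod_normE /dot2 /= !gt_max => /andP[h1 h2] /andP[h3 h4].
set m := Num.max _ _ in h1 h2 h3 h4.
have m0 : 0 < m by move: h1; have := normr_ge0 (a - x); lra.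
move: h1 h2 h3 h4; rewrite !ltr_norml => /andP[h1 h1'] /andP[h2 h2'] /andP[h3 h3'] /andP[h4 h4'].
have key (z p q r s : R) : `|z| = m -> - (m / 4) < p - z -> p - z < m / 4 ->
    - (m / 4) < q - z -> q - z < m / 4 ->
    r - s < m / 2 -> s - r < m / 2 -> 0 < p * q + r * s.
  move=> zm p1 p2 q1 q2 r1 r2.
  have pq : m ^+ 2 / 4 < p * q.
    have big f g : 0 < f - m / 2 -> 0 < g - m / 2 -> m ^+ 2 / 4 < f * g.
      by move=> ha hb; have := mulr_gt0 ha hb; have := mulr_gt0 m0 ha;
         have := mulr_gt0 m0 hb; lra.
    case: (lerP 0 z) zm => [/ger0_norm -> | /ltr0_norm ->] zm; first by apply: big; lra.
    by rewrite -(mulrNN p); apply: big; lra.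
  have : - (m ^+ 2 / 4) <= r * s by nra.
  by lra.
have [xm | xm] := leP `|y| `|x|.
  have mx : `|x| = m by rewrite /m max_l.
  by clearbody m; apply: (key x) => //; lra.
have mx : `|y| = m by rewrite /m max_r // ltW.
by rewrite addrC; clearbody m; apply: (key y) => //; lra.
Qed.

Definition sample (N : nat) (p : R -> R * R) (i : nat) := p (i%:R / N.+1%:R).

Lemma unit_near (p : R -> R * R) (s0 e : R) : {within `[0, 1], continuous p} ->
  s0 \in `[0, 1] -> 0 < e ->
  exists2 d : R, 0 < d & forall s : R, s \in `[0, 1] -> `|s - s0| < d -> `|p s - p s0| < e.
Proof.
move=> /subspace_continuousP cp s01 e0.
have /cvgrPdist_lt /(_ e e0) := cp s0 s01.
rewrite near_withinE => /nbhs_ballP[d /= d0 sub]; exists d => // s s1 sd.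
by rewrite distrC; apply: sub => //; rewrite /ball /= distrC.
Qed.

(** On the compact unit square the nonvanishing map [p s - q t] is uniformly
    continuous and bounded away from 0. *)
Lemma fine_grid (p q : R -> R * R) :
  {within `[0, 1], continuous p} -> {within `[0, 1], continuous q} ->
  (forall s t : R, s \in `[0, 1] -> t \in `[0, 1] -> p s != q t) ->
  \forall N \near \oo, forall s t s' t' : R, s \in `[0, 1] -> t \in `[0, 1] ->
    s' \in `[0, 1] -> t' \in `[0, 1] ->
    `|s' - s| <= N.+1%:R^-1 -> `|t' - t| <= N.+1%:R^-1 ->
    0 < dot2 (p s - q t) (p s' - q t').
Proof.
move=> cp cq dis.
have K : compact (`[0, 1]%classic `*` `[0, 1]%classic : set (R * R)).
  by apply: compact_setX; exact: segment_compact.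
move: K => /compact_near_coveringP /near_covering_withinP K.
have {K} := K _ \oo (fun N (x : R * R) => forall s' t', s' \in `[0, 1] -> t' \in `[0, 1] ->
    `|s' - x.1| <= N.+1%:R^-1 -> `|t' - x.2| <= N.+1%:R^-1 ->
    0 < dot2 (p x.1 - q x.2) (p s' - q t')) _.
case=> [[s0 t0] /= [s01 t01]|N _ HN]; last first.
  by exists N => // n Nn s t s' t' s1 t1; apply: (HN n Nn (s, t)).
set u := p s0 - q t0; have u0 : 0 < `|u| / 8.
  by rewrite divr_gt0 // normr_gt0 subr_eq0 dis.
have [d1 d10 H1] := unit_near cp s01 u0.
have [d2 d20 H2] := unit_near cq t01 u0.
pose d := Num.min d1 d2 / 2.
have d0 : 0 < d by rewrite /d divr_gt0 // lt_min d10.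
have [dd1 dd2] : 2 * d <= d1 /\ 2 * d <= d2.
  have l1 : Num.min d1 d2 <= d1 by rewrite ge_min lexx.
  have l2 : Num.min d1 d2 <= d2 by rewrite ge_min lexx orbT.
  by rewrite /d; split; lra.
exists (ball s0 d `*` ball t0 d, [set N | (N.+1%:R^-1 < d)%R]) => /=.
  split; last exact: (near_infty_natSinv_lt (PosNum d0)).
  by exists (ball s0 d, ball t0 d) => //; split; exact: nbhsx_ballx.
move=> [[s t] N] /= [[sd td] Nd] [s1 t1] s' t' s'1 t'1 /= s's t't.
have close s2 t2 : s2 \in `[0, 1] -> t2 \in `[0, 1] -> `|s2 - s0| < d1 ->
    `|t2 - t0| < d2 -> `|(p s2 - q t2) - u| < `|u| / 4.
  move=> s21 t21 a b; have -> : p s2 - q t2 - u = (p s2 - p s0) - (q t2 - q t0).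
    by rewrite /u !opprB [q t0 - p s0]addrC addrACA [- q t2 + _]addrC.
  apply: le_lt_trans (ler_normB _ _) _.
  by have := H1 _ s21 a; have := H2 _ t21 b; lra.
move: sd td; rewrite /ball /= distrC [`|t0 - t|]distrC => sd td.
have triangle (a b c e : R) : 2 * d <= e -> `|b - a| <= N.+1%:R^-1 -> `|a - c| < d ->
    `|b - c| < e.
  move=> de ba ac; apply: le_lt_trans (ler_distD a b c) _; apply: lt_le_trans de.
  by rewrite mulr_natl mulr2n ltrD // (le_lt_trans ba).
have half (a c e : R) : 2 * d <= e -> `|a - c| < d -> `|a - c| < e.
  by move=> de /lt_le_trans; apply; apply: le_trans de; rewrite mulr_natl mulr2n lerDl ltW.
by apply: (@dot2_near u); apply: close;
  rewrite // ?(triangle _ _ _ _ dd1 s's sd) ?(triangle _ _ _ _ dd2 t't td)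
    ?(half _ _ _ dd1) ?(half _ _ _ dd2).
Qed.

(** The van Kampen identity modulo 2 for two disjoint arcs. *)
Lemma arcs_exchange (p q : R -> R * R) :
  {within `[0, 1], continuous p} -> {within `[0, 1], continuous q} ->
  (forall s t : R, s \in `[0, 1] -> t \in `[0, 1] -> p s != q t) ->
  \forall N \near \oo,
    winding N.+1 (q 0) (sample N p) (+) winding N.+1 (q 1) (sample N p) (+)
      (winding N.+1 (p 0) (sample N q) (+) winding N.+1 (p 1) (sample N q)) =
    upper (q 0 - p 0) (+) upper (q 1 - p 0) (+) (upper (q 0 - p 1) (+) upper (q 1 - p 1)).
Proof.
move=> cp cq dis; apply: filterS (fine_grid cp cq dis) => N fine.
have Np : 0 < N.+1%:R :> R by rewrite ltr0n.
have unit i : (i <= N.+1)%N -> i%:R / N.+1%:R \in `[0, 1 : R].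
  by move=> iN; rewrite in_itv /= divr_ge0 ?ler0n //= ler_pdivrMr // mul1r ler_nat.
have near_pt i i' : (i <= i' <= i.+1)%N ->
    `|i'%:R / N.+1%:R - i%:R / N.+1%:R| <= N.+1%:R^-1 :> R.
  case/andP=> ii' i'i; rewrite -mulrBl normrM [`|_^-1|]ger0_norm ?invr_ge0 ?ler0n //.
  rewrite ler_piMl ?invr_ge0 ?ler0n // -natrB // normr_nat lern1.
  by rewrite leq_subLR addn1.
have e0 (f : R -> R * R) : f 0 = sample N f 0%N by rewrite /sample mul0r.
have e1 (f : R -> R * R) : f 1 = sample N f N.+1 by rewrite /sample divff // gt_eqF.
rewrite (e0 p) (e0 q) (e1 p) (e1 q); apply: winding_exchange => [i j iN jN|].
  by apply: dis; apply: unit.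
move=> i j i' j' iN jN /andP[ii i'i] /andP[jj j'j]; apply: fine.
- by apply/unit/ltnW.
- by apply/unit/ltnW.
- exact/unit/(leq_trans i'i).
- exact/unit/(leq_trans j'j).
- by apply: near_pt; rewrite ii.
- by apply: near_pt; rewrite jj.
Qed.

End FineGrid.

(** * Graphs with a crossing parity *)

(** In a plane drawing, [t c a b] is the parity of the number of times that the arc
    from [a] to [b] crosses the ray to the right of [c], and [L a c] tells whether
    [c] lies above [a]. The equation is the vanishing of the van Kampen
    obstruction modulo 2 of [e]: its right-hand side is the crossing parity of the
    independent edges [a b] and [c d] in a drawing that depends on [L] only, and
    the left-hand side is a coboundary. *)
Definition crossing_parity (T : finType) (e : rel T) :=
  exists (t : T -> T -> T -> bool) (L : rel T),
    (forall u v, u != v -> L v u = ~~ L u v) /\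
    (forall a b c d, e a b -> e c d -> uniq [:: a; b; c; d] ->
       t c a b (+) t d a b (+) (t a c d (+) t b c d) =
       L a c (+) L a d (+) (L b c (+) L b d)).

Section PlanarParity.
Variable R : realType.
Local Open Scope classical_set_scope.
Local Open Scope ring_scope.

(** The arcs of two edges without common end are disjoint. As there are finitely
    many such pairs, one subdivision is fine enough for all of them. *)
Lemma planar_crossing_parity (G : sgraph) : planar R G -> crossing_parity (@adj G).
Proof.
move=> [pos [arc [pos_inj arcP _ cross]]].
have pathP (ab : G * G) : exists f : R -> R * R, adj ab.1 ab.2 ->
    [/\ {within `[0, 1], continuous f}, f 0 = pos ab.1, f 1 = pos ab.2 &
        forall s : R, s \in `[0, 1] -> arc [set ab.1; ab.2]%SET (f s)].
  case: (boolP (adj ab.1 ab.2)) => [/arcP[f [cf _ f0 f1 fA]]|_]; last by exists (fun=> (0, 0)).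
  by exists f => _; split=> // s s01; rewrite fA; exists s.
have [gam gamP] := choice pathP.
have disj a b c d : adj a b -> adj c d -> uniq [:: a; b; c; d] ->
    forall s t : R, s \in `[0, 1] -> t \in `[0, 1] -> gam (a, b) s != gam (c, d) t.
  move=> ab cd; rewrite /= !inE !negb_or => /and4P[/and3P[_ ac ad] /andP[bc bd] _ _] s t s1 t1.
  have [_ _ _ Aab] := gamP (a, b) ab; have [_ _ _ Acd] := gamP (c, d) cd.
  apply/eqP=> est.
  have dis : [set a; b]%SET != [set c; d]%SET.
    apply/eqP=> /setP/(_ a); rewrite !inE eqxx (negbTE ac) (negbTE ad) //.
  have [u] := cross _ _ _ _ ab cd dis _ (Aab s s1) (eq_rect _ _ (Acd t t1) _ (esym est)).
  by rewrite !inE => /andP[/orP[]/eqP-> /orP[]/eqP uu]; move: ac ad bc bd; rewrite uu eqxx.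
have [N _ HN] : \forall N \near \oo, forall x : G * G * (G * G),
   adj x.1.1 x.1.2 -> adj x.2.1 x.2.2 -> uniq [:: x.1.1; x.1.2; x.2.1; x.2.2] ->
   winding N.+1 (pos x.2.1) (sample N (gam x.1)) (+) winding N.+1 (pos x.2.2) (sample N (gam x.1)) (+)
      (winding N.+1 (pos x.1.1) (sample N (gam x.2)) (+) winding N.+1 (pos x.1.2) (sample N (gam x.2))) =
    upper (pos x.2.1 - pos x.1.1) (+) upper (pos x.2.2 - pos x.1.1) (+)
    (upper (pos x.2.1 - pos x.1.2) (+) upper (pos x.2.2 - pos x.1.2)).
  apply: filter_forall => -[[a b] [c d]] /=.
  case: (boolP (adj a b)) => ab; last by apply: nearW.
  case: (boolP (adj c d)) => cd; last by apply: nearW.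
  case: (boolP (uniq [:: a; b; c; d])) => un; last by apply: nearW => N _ _ /(negP un).
  have [cab ab0 ab1 _] := gamP (a, b) ab; have [ccd cd0 cd1 _] := gamP (c, d) cd.
  move: (arcs_exchange cab ccd (disj _ _ _ _ ab cd un)).
  by rewrite ab0 ab1 cd0 cd1 /=; apply: filterS.
exists (fun c a b => winding N.+1 (pos c) (sample N (gam (a, b)))).
exists (fun u v => upper (pos v - pos u)); split=> [u v uv|a b c d ab cd un].
  rewrite -opprB upperN // subr_eq0; apply: contraNneq uv => /pos_inj ->; exact: eqxx.
exact: (HN N (leqnn N) (a, b, (c, d))).
Unshelve. all: by end_near. Qed.

End PlanarParity.

Lemma addb_xorb b1 b2 : b1 (+) b2 = xorb b1 b2.
Proof. by case: b1 b2 => [] []. Qed.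

Lemma xor_eq (a b c d : bool) : a = b -> a (+) b = c (+) d -> c = d.
Proof. by case: a b c d => [] [] [] []. Qed.

Lemma xor_eq2 (a b a1 b1 a2 b2 : bool) :
  (a1 (+) b1) (+) (a2 (+) b2) = a (+) b -> a1 = b1 -> a2 = b2 -> a = b.
Proof. by case: a b a1 b1 a2 b2 => [] [] [] [] [] []. Qed.

Lemma xor_neq (a b : bool) : a (+) b = true -> a = b -> False.
Proof. by case: a b => [] []. Qed.

Ltac xor_ring := rewrite !addb_xorb; btauto.

Section ParityMinors.
Variable T : finType.
Implicit Types (e : rel T) (S : {set T}).

Lemma parity_sub e e' : subrel e' e -> crossing_parity e -> crossing_parity e'.
Proof.
move=> sub [t [L [LC ex]]]; exists t, L; split=> // a b c d ab cd.
by apply: ex; apply: sub.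
Qed.

(** An edge [y w] that becomes [x w] is rerouted along [x y], so that the crossings
    of [x y] are added to its own. The equations of [y w] and of [x y] with a third
    edge add up to that of the new edge, as the terms at [y] cancel. *)
Lemma parity_contract e x y : symmetric e -> e x y -> crossing_parity e ->
  crossing_parity (contract e x y).
Proof.
move=> sym exy [t [L [LC ex]]].
(* The edge [u v] is new exactly when [e u v] fails. *)
pose t' c u v := if e u v then t c u v else
  if u == x then t c y v (+) t c x y else t c u y (+) t c x y.
have split_edge a b : contract e x y a b ->
    [\/ e a b, [/\ ~~ e a b, a = x & e y b] | [/\ ~~ e a b, b = x & e a y]].
  rewrite /contract => /and4P[_ _ _]; case: (boolP (e a b)) => [|nab] /=; first by constructor 1.
  by case/orP=> /andP[/eqP-> ?]; [constructor 2 | constructor 3].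
have away a b : contract e x y a b -> (a != y) && (b != y) by case/and4P=> -> ->.
have old a b c : e a b -> t' c a b = t c a b by rewrite /t' => ->.
have key a b c d : contract e x y a b -> ~~ e a b -> e c d -> c != y -> d != y ->
    uniq [:: a; b; c; d] ->
    t' c a b (+) t' d a b (+) (t a c d (+) t b c d) =
       L a c (+) L a d (+) (L b c (+) L b d).
  move=> eab nab cd cy dy un; have /andP[ay by'] := away _ _ eab.
  rewrite /t' (negbTE nab); case: (split_edge _ _ eab) => [|[_ ax yb]|[_ bx ya]].
  - by rewrite (negbTE nab).
  - rewrite {}ax eqxx in un ay *.
    have un1 : uniq [:: y; b; c; d].
      move: un; rewrite /= !inE !negb_or => /and4P[/and3P[_ _ _] -> -> _].
      by rewrite (eq_sym y b) by' !(eq_sym y) cy dy.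
    have un2 : uniq [:: x; y; c; d].
      move: un; rewrite /= !inE !negb_or => /and4P[/and3P[_ -> ->] _ -> _].
      by rewrite ay !(eq_sym y) cy dy.
    refine (xor_eq2 _ (ex _ _ _ _ yb cd un1) (ex _ _ _ _ exy cd un2)); xor_ring.
  - have nax : (a == x) = false.
      by apply/negbTE; move: un; rewrite bx /= !inE !negb_or => /and4P[/and3P[]].
    rewrite nax {}bx in un by' *.
    have un1 : uniq [:: a; y; c; d].
      move: un; rewrite /= !inE !negb_or => /and4P[/and3P[_ -> ->] _ -> _].
      by rewrite ay !(eq_sym y) cy dy.
    have un2 : uniq [:: x; y; c; d].
      move: un; rewrite /= !inE !negb_or => /and4P[_ /andP[-> ->] -> _].
      by rewrite by' !(eq_sym y) cy dy.
    refine (xor_eq2 _ (ex _ _ _ _ ya cd un1) (ex _ _ _ _ exy cd un2)); xor_ring.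
exists t', L; split=> // a b c d eab ecd un.
have /andP[ay by'] := away _ _ eab; have /andP[cy dy] := away _ _ ecd.
have un' : uniq [:: c; d; a; b].
  by rewrite -[[:: c; d; a; b]]/([:: c; d] ++ [:: a; b]) uniq_catC.
have [ab|nab] := boolP (e a b); have [cd|ncd] := boolP (e c d).
- by rewrite !old // ex.
- have k := key _ _ _ _ ecd ncd ab ay by' un'; rewrite !(old a b) //; apply: (xor_eq k).
  move: un; rewrite /= !inE !negb_or => /and4P[/and3P[_ ac ad] /andP[bc bd] _ _].
  rewrite (LC a c ac) (LC a d ad) (LC b c bc) (LC b d bd).
  xor_ring.
- by rewrite !(old c d) //; exact: key.
- move: un; case: (split_edge _ _ eab) => [|[_ -> _]|[_ -> _]]; first by rewrite (negbTE nab).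
  + case: (split_edge _ _ ecd) => [|[_ -> _]|[_ -> _]]; first by rewrite (negbTE ncd).
      by rewrite /= !inE eqxx ?orTb ?orbT ?andbF.
    by rewrite /= !inE eqxx ?orTb ?orbT ?andbF.
  + case: (split_edge _ _ ecd) => [|[_ -> _]|[_ -> _]]; first by rewrite (negbTE ncd).
      by rewrite /= !inE eqxx ?orTb ?orbT ?andbF.
    by rewrite /= !inE eqxx ?orTb ?orbT ?andbF.
Qed.

(** Comparing indices keeps one of the two orders of each pair of edges. *)
Definition opposite_edges (es : seq (nat * nat)) :=
  [seq fg <- [seq (f, g) | f <- es, g <- es] |
     (index fg.1 es < index fg.2 es) && uniq [:: fg.1.1; fg.1.2; fg.2.1; fg.2.2]].

(** Writing every value of [L] through the pairs [i < j] lets the values at a pair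
    cancel in a sum, up to negations. *)
Definition oriented (L : rel T) (v : nat -> T) i j :=
  if i < j then L (v i) (v j) else ~~ L (v j) (v i).

(** The sum of the equations of all pairs of disjoint edges in the subgraph [es],
    whose vertices are numbered by their rank in [s]. *)
Lemma parity_sum e (s : seq T) x0 (es : seq (nat * nat)) : uniq s ->
  (forall f, f \in es -> [&& f.1 < size s, f.2 < size s & e (nth x0 s f.1) (nth x0 s f.2)]) ->
  crossing_parity e -> let v := nth x0 s in
  exists t (L : rel T),
    foldr addb false [seq t (v fg.2.1) (v fg.1.1) (v fg.1.2) (+) t (v fg.2.2) (v fg.1.1) (v fg.1.2) (+)
        (t (v fg.1.1) (v fg.2.1) (v fg.2.2) (+) t (v fg.1.2) (v fg.2.1) (v fg.2.2))
        | fg <- opposite_edges es] =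
    foldr addb false [seq oriented L v fg.1.1 fg.2.1 (+) oriented L v fg.1.1 fg.2.2 (+)
        (oriented L v fg.1.2 fg.2.1 (+) oriented L v fg.1.2 fg.2.2) | fg <- opposite_edges es].
Proof.
move=> us edge [t [L [LC ex]]] v; exists t, L; congr (foldr _ _ _); apply/eq_in_map.
move=> [[p q] [r w]]; rewrite mem_filter /= => /andP[/andP[_ un] /allpairsP[[f g] [/= fes ges [fE gE]]]].
move: (edge f fes) (edge g ges); rewrite -fE -gE /= => /and3P[ps qs epq] /and3P[rs ws erw].
have orientE i j : i < size s -> j < size s -> i != j -> L (v i) (v j) = oriented L v i j.
  move=> si sj ij; rewrite /oriented; case: ltngtP => // E; last by rewrite E eqxx in ij.
  by apply: LC; rewrite /v nth_uniq // ltn_eqF.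
have unv : uniq [:: v p; v q; v r; v w].
  by move: un; rewrite /= !inE /v !nth_uniq.
move: un; rewrite /= !inE !negb_or => /and4P[/and3P[_ pr pw] /andP[qr qw] _ _].
by rewrite -!orientE //; apply: ex.
Qed.

Definition K5_edges := [seq (i, j) | i <- iota 0 5, j <- iota i.+1 (4 - i)].

(** In the sum of the fifteen equations each [t c a b] occurs twice, once for each
    of the two edges at [c] that are disjoint from [a b], and each [L u v] occurs
    six times; only the negations remain, and their number is odd. *)
Lemma K5_no_parity e (a b c d f : T) : uniq [:: a; b; c; d; f] ->
  {in [:: a; b; c; d; f] &, forall u v, u != v -> e u v} -> ~ crossing_parity e.
Proof.
move=> us K par; have [|t [L]] := @parity_sum e _ a K5_edges us _ par.
  move=> f0 /allpairsPdep[i [j [/=]]]; rewrite !mem_iota => i5 j5 -> /=.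
  have si : i < size [:: a; b; c; d; f] by move: i5; rewrite /=; lia.
  have sj : j < size [:: a; b; c; d; f] by move: i5 j5; rewrite /=; lia.
  apply/and3P; split=> //; apply: K; rewrite ?mem_nth // nth_uniq //; lia.
set qs := opposite_edges _; vm_compute in qs; rewrite {}/qs /= /oriented /=.
by apply: xor_neq; xor_ring.
Qed.

Definition K33_edges := [seq (i, j) | i <- iota 0 3, j <- iota 3 3].

(** As for [K5], every [t c a b] occurs twice in the sum of the eighteen equations,
    every [L u v] occurs an even number of times, and an odd number of negations
    remains. *)
Lemma K33_no_parity e (a1 a2 a3 b1 b2 b3 : T) : uniq [:: a1; a2; a3; b1; b2; b3] ->
  (forall u v, u \in [:: a1; a2; a3] -> v \in [:: b1; b2; b3] -> e u v) ->
  ~ crossing_parity e.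
Proof.
move=> us K par; have [|t [L]] := @parity_sum e _ a1 K33_edges us _ par.
  move=> f /allpairsP[[i j] []]; rewrite !mem_iota => /= i3 j3 -> /=.
  apply/and3P; split; [by lia | by lia | apply: K].
    have -> : nth a1 [:: a1; a2; a3; b1; b2; b3] i = nth a1 [:: a1; a2; a3] i.
      by case: i i3 => [|[|[]]].
    by rewrite mem_nth //=; lia.
  have -> : nth a1 [:: a1; a2; a3; b1; b2; b3] j = nth a1 [:: b1; b2; b3] (j - 3).
    by case: j j3 => [|[|[|[|[|[]]]]]].
  by rewrite mem_nth //=; lia.
set qs := opposite_edges _; vm_compute in qs; rewrite {}/qs /= /oriented /=.
by apply: xor_neq; xor_ring.
Qed.

End ParityMinors.

Section EdgeBound.
Variable T : finType.
Implicit Types (e : rel T) (S N : {set T}).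

(** Each neighbour of [x] is adjacent to at least three others, so that [x] has four
    or five neighbours, and each of them has at most one nonneighbour among
    them. If [z] and [w] are nonadjacent, they are, like [x], joined to the three
    remaining neighbours, giving a [K33]; otherwise [x] and four of its neighbours
    form a [K5]. *)
Lemma low_degree_obstruction e S x : symmetric e -> irreflexive e ->
  0 < #|nbrs e S x| -> #|nbrs e S x| <= 5 ->
  (forall y, y \in nbrs e S x -> 3 <= #|nbrs e S x :&: nbrs e S y|) ->
  ~ crossing_parity e.
Proof.
move=> sym irr; set N := nbrs e S x => N0 N5 common.
have xN y : y \in N -> e x y by rewrite inE => /andP[].
have nxN : x \notin N by rewrite inE irr andbF.
have common_sub y : y \in N -> N :&: nbrs e S y \subset N :\ y.
  move=> _; apply/subsetP=> z; rewrite !inE => /andP[/andP[-> ->] /andP[_ eyz]].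
  by rewrite !andbT; apply: contraTneq eyz => ->; rewrite irr.
have N4 : 3 < #|N|.
  case/card_gt0P: N0 => y yN; have := subset_leq_card (common_sub y yN).
  by have := common y yN; rewrite (cardsD1 y N) yN; lia.
have [/existsP[z /existsP[w /and4P[zN wN zw nzw]]] | clique] :=
  boolP [exists z, exists w, [&& z \in N, w \in N, z != w & ~~ e z w]].
- (* [x], [z], [w] are all joined to the rest of [N] *)
  pose B := N :\ z :\ w.
  have full u v : u \in N -> v \in N -> u != v -> ~~ e u v ->
      N :&: nbrs e S u \subset N :\ u :\ v.
    move=> uN vN uv nuv; rewrite subsetD1 common_sub //= in_setI [v \in nbrs _ _ _]inE.
    by rewrite (negbTE nuv) !andbF.
  have cB : #|N| = #|B|.+2.
    by rewrite (cardsD1 z N) zN (cardsD1 w (N :\ z)) in_setD1 eq_sym zw wN.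
  have B3 : #|B| = 3.
    by have := subset_leq_card (full z w zN wN zw nzw); have := common z zN; rewrite -/B; lia.
  have zB : N :&: nbrs e S z = B.
    by apply/eqP; rewrite eqEcard full // -/B B3 common.
  have wB : N :&: nbrs e S w = B.
    have -> : B = N :\ w :\ z by rewrite /B !setDDl setUC.
    have e3 : #|N :\ w :\ z| = 3 by rewrite setDDl setUC -setDDl.
    by apply/eqP; rewrite eqEcard full ?e3 ?common // 1?eq_sym // sym.
  have [ez ew] : (forall b, b \in B -> e z b) /\ (forall b, b \in B -> e w b).
    by split=> b; [rewrite -zB | rewrite -wB]; rewrite inE => /andP[_]; rewrite inE => /andP[].
  have BN b : b \in B -> b \in N by rewrite !inE => /and3P[_ _].
  have := enum_uniq B; have memB b : (b \in enum B) = (b \in B) by rewrite mem_enum.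
  move: B3 memB; rewrite cardE; case: (enum B) => [|b1 [|b2 [|b3 []]]] // _ memB uB.
  apply: (@K33_no_parity _ e x z w b1 b2 b3); last first.
    move=> u v + vB; rewrite memB in vB; rewrite !inE => /or3P[] /eqP->.
    + exact/xN/BN.
    + exact: ez.
    + exact: ew.
  have notB u : u \notin B -> u \notin [:: b1; b2; b3] by rewrite memB.
  have -> : [:: x; z; w; b1; b2; b3] = [:: x; z; w] ++ [:: b1; b2; b3] by [].
  rewrite cat_uniq uB andbT; apply/andP; split.
    rewrite /= !inE zw !andbT negb_or.
    by apply/andP; split; apply: contraNneq nxN => ->.
  apply/hasPn => b; rewrite memB => bB; rewrite !inE !negb_or.
  rewrite (contraTneq _ bB) => [|->]; last by apply: contra nxN; apply: BN.
  by move: bB; rewrite !inE => /and3P[-> -> _].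
- have cl u v : u \in N -> v \in N -> u != v -> e u v.
    move=> uN vN uv; apply: contraNT clique => nuv.
    by apply/existsP; exists u; apply/existsP; exists v; rewrite uN vN uv.
  have := enum_uniq N; have memN b : (b \in enum N) = (b \in N) by rewrite mem_enum.
  have := N4; rewrite cardE.
  case: (enum N) memN => [|b1 [|b2 [|b3 [|b4 s]]]] // memN _ uN.
  have bN b : b \in [:: b1; b2; b3; b4] -> b \in N.
    by rewrite -memN => bs; rewrite (mem_cat b [:: b1; b2; b3; b4] s) bs.
  apply: (@K5_no_parity _ e x b1 b2 b3 b4).
    have u4 : uniq [:: b1; b2; b3; b4].
      by move: uN; rewrite (cat_uniq [:: b1; b2; b3; b4] s) => /andP[].
    by rewrite cons_uniq u4 andbT; apply: contra nxN; apply: bN.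
  move=> u v; rewrite (in_cons _ _ u) (in_cons _ _ v).
  case/predU1P=> [-> | /bN uN']; case/predU1P=> [-> | /bN vN']; rewrite ?eqxx //.
  + by move=> _; apply: xN.
  + by move=> _; rewrite sym; apply: xN.
  + exact: cl.
Qed.

(** Induction on the number of vertices, then on the number of edges. If there are
    as many as [3 * #|S|] edges, one of them can be deleted. Otherwise some vertex
    [x] has degree at most 5. It is not isolated, as it could be deleted; and each
    of its edges lies in three triangles, as contracting an edge in at most two
    triangles loses at most three edges. *)
Lemma parity_edge_bound e S : symmetric e -> irreflexive e -> crossing_parity e ->
  3 <= #|S| -> arcs e S + 12 <= 6 * #|S|.
Proof.
have [n] := ubnP #|S|; elim: n e S => // n IHn e S Sn.
have [m] := ubnP (arcs e S); elim: m e => // m IHm e em sym irr par S3.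
rewrite leqNgt; apply/negP=> big.
have S4 : 3 < #|S|.
  have := S3; rewrite leq_eqVlt => /predU1P[E|//].
  by have := arcs_le S irr; rewrite -E /=; lia.
have [many | few] := leqP (6 * #|S|) (arcs e S).
  have [x xS /card_gt0P[y]] : exists2 x, x \in S & 0 < #|nbrs e S x|.
    apply/exists_inP; apply: contraLR many => /exists_inPn none.
    rewrite /arcs big1 => [|x /none]; last by rewrite -eqn0Ngt => /eqP.
    by lia.
  rewrite inE => /andP[yS exy].
  have e2 := arcs_del_edge sym irr xS yS exy.
  have : arcs (del_edge e x y) S + 12 <= 6 * #|S|.
    apply: IHm => //; [by lia | exact: del_edge_sym | | ].
      by move=> u; rewrite /del_edge irr.
    by apply: parity_sub par => u v /andP[].
  by lia.
have [x xS dx] : exists2 x, x \in S & #|nbrs e S x| < 6.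
  apply/exists_inP; apply: contraLR few => /exists_inPn none.
  rewrite -leqNgt mulnC -sum_nat_const; apply: leq_sum => x /none.
  by rewrite -leqNgt.
have cD y : y \in S -> #|S| = #|S :\ y|.+1 by move=> yS; rewrite (cardsD1 y) yS.
have [d0 | d0] := posnP #|nbrs e S x|.
  have : arcs e (S :\ x) + 12 <= 6 * #|S :\ x|.
    by have := cD x xS => cS; apply: IHn => //; lia.
  by have := arcs_D1 sym irr xS; have := cD x xS; lia.
apply: (low_degree_obstruction sym irr d0 _ _ par) => // y.
rewrite inE => /andP[yS exy].
have : arcs (contract e x y) (S :\ y) + 12 <= 6 * #|S :\ y|.
  have := cD y yS => cS; apply: IHn; [by lia | exact: contract_sym | exact: contract_irrefl | | by lia].
  exact: parity_contract.
by have := arcs_contract sym irr xS yS exy; have := cD y yS; lia.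
Qed.

Lemma parity_arcs_le e S : symmetric e -> irreflexive e -> crossing_parity e ->
  arcs e S <= 6 * #|S|.
Proof.
move=> sym irr par; have [S3 | S3] := leqP 3 #|S|.
  by have := parity_edge_bound sym irr par S3; lia.
by apply: leq_trans (arcs_le S irr) _; rewrite mulnC leq_mul2r; lia.
Qed.

End EdgeBound.

(** * Sparsity of splittable graphs *)

Section SplitCount.

Definition lifts_edges (G H : sgraph) (pi : H -> G) :=
  forall u v : G, adj u v -> exists x y : H, [/\ pi x = u, pi y = v & adj x y].

Lemma card_preimset (aT rT : finType) (f : aT -> rT) (S : {set rT}) :
  #|f @^-1: S| = \sum_(v in S) #|[pred x | f x == v]|.
Proof.
rewrite -sum1_card (partition_big f (fun v => v \in S)) => [|x]; last by rewrite inE.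
apply: eq_bigr => v vS; rewrite -sum1_card; apply: eq_bigl => x; rewrite !inE.
by case: eqP => [->|]; rewrite ?vS ?andbF.
Qed.

Lemma arcs_lift (G H : sgraph) (pi : H -> G) (S : {set G}) : lifts_edges pi ->
  arcs (@adj G) S <= arcs (@adj H) (pi @^-1: S).
Proof.
move=> lift; rewrite !arcs_card.
apply: leq_trans (leq_imset_card (fun p : H * H => (pi p.1, pi p.2)) _).
apply: subset_leq_card; apply/subsetP=> -[u v]; rewrite inE => /and3P[/= uS vS /lift].
case=> x [y [xu yv xy]]; apply/imsetP; exists (x, y); last by rewrite /= xu yv.
by rewrite !inE /= xu yv uS vS.
Qed.

(** A vertex is split at most once, so the copies of a vertex in the final graph
    arise in a single step. The bound 1 outside [U] is what makes the bounds
    compose: the copies created by a split are never split again. *)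
Lemma splits_on_lift (k : nat) (G K : sgraph) (U : {set G}) : 0 < k -> splits_on k U K ->
  exists pi : K -> G,
    (forall v, #|[pred x | pi x == v]| <= if v \in U then k else 1) /\ lifts_edges pi.
Proof.
move=> k0; elim=> {G K U} [G U | G H K U v pi vU [fib1 fibk adjE _ adjv] _ [rho [fib lift]]].
  exists id; split=> [v|u v uv]; last by exists u, v.
  have -> : #|[pred x | x == v]| = 1 by rewrite -(card1 v); apply: eq_card.
  by case: ifP.
exists (pi \o rho); split=> [w | u w uw].
  have -> : #|[pred x | pi (rho x) == w]| = \sum_(y | pi y == w) #|[pred x | rho x == y]|.
    have := card_preimset rho [set y | pi y == w].
    rewrite (eq_bigl (fun y => pi y == w)) => [<-|y]; last by rewrite inE.
    by apply: eq_card => x; rewrite !inE.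
  have bound c : (forall y, pi y == w -> #|[pred x | rho x == y]| <= c) ->
      \sum_(y | pi y == w) #|[pred x | rho x == y]| <= #|[pred y | pi y == w]| * c.
    by move=> le_c; rewrite -sum_nat_const; apply: leq_sum => y; apply: le_c.
  have [-> {bound} | wv] := eqVneq w v.
    rewrite vU; apply: leq_trans fibk; rewrite -sum1_card; apply: leq_sum => y /eqP piy.
    by apply: leq_trans (fib y) _; rewrite !inE piy eqxx.
  apply: leq_trans (bound (if w \in U then k else 1) _) _; last by rewrite fib1 // mul1n.
  by move=> y /eqP piy; have := fib y; rewrite !inE piy wv.
have pre z : z != v -> exists x, pi x = z.
  by move=> /fib1 /eqP; rewrite eqn_leq => /andP[_ /card_gt0P[x /eqP]]; exists x.
have {uw} [x [y [<- <- /lift[x' [y' [<- <- xy]]]]]] :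
    exists x y, [/\ pi x = u, pi y = w & adj x y].
  have [uv | uv] := eqVneq u v.
    have wv : w != v by apply: contraTneq uw => ->; rewrite uv adj_irrefl.
    have [y yw] := pre w wv; rewrite uv -yw in uw *.
    by have [x xv xy] := adjv y uw; exists x, y.
  have [x xu] := pre u uv; have [wv | wv] := eqVneq w v.
    rewrite wv adj_sym -xu in uw *; have [y yv yx] := adjv x uw.
    by exists x, y; rewrite adj_sym.
  by have [y yw] := pre w wv; exists x, y; rewrite adjE ?xu ?yw.
by exists x', y'.
Qed.

Lemma splittable_arcs (R : realType) (k : nat) (G : sgraph) (S : {set G}) : 0 < k ->
  splittable R k G -> arcs (@adj G) S <= 6 * k * #|S|.
Proof.
move=> k0 [H spl /planar_crossing_parity par].
have [pi [fib lift]] := splits_on_lift k0 spl.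
apply: leq_trans (arcs_lift S lift) _.
apply: leq_trans (parity_arcs_le _ (@adj_sym H) (@adj_irrefl H) par) _.
rewrite -mulnA leq_mul2l /= card_preimset mulnC -sum_nat_const.
by apply: leq_sum => v _; have := fib v; rewrite inE.
Qed.

End SplitCount.

(** * Noncrossing layouts of pseudoforests *)

Section FindCycle.
Variables (T : finType) (e : rel T).
Hypotheses (sym : symmetric e) (irr : irreflexive e).
Implicit Types S : {set T}.

Definition cycle_in S (p : seq T) := [&& 2 < size p, uniq p, cycle e p & all (mem S) p].

(** A path that cannot be extended beyond its start [x] contains all neighbours of
    [x]; one that does not follow [x] on the path closes a cycle. *)
Lemma mindeg2_cycle S : S != set0 -> (forall x, x \in S -> 1 < #|nbrs e S x|) ->
  exists p, cycle_in S p.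
Proof.
move=> /set0Pn[x0 x0S] deg2.
have [[p Cp] | noC] := boolp.pselect (exists p, cycle_in S p); first by exists p.
have long n : exists x s, [/\ path e x s, uniq (x :: s), all (mem S) (x :: s) & size s = n].
  elim: n => [|n [x [s [ps us Ss sn]]]]; first by exists x0, [::]; rewrite /= x0S.
  have xS : x \in S by move: Ss => /andP[].
  have [y yN ys] : exists2 y, y \in nbrs e S x & y \notin s.
    apply/subsetPn/negP => /subsetP sub.
    have [y yN yh] : exists2 y, y \in nbrs e S x & y != head x s.
      have := deg2 x xS; rewrite (cardsD1 (head x s)).
      case: (set_0Vmem (nbrs e S x :\ head x s)) => [-> | [y]]; first by rewrite cards0; case: (_ \in _).
      by rewrite !inE => /and3P[yh yS exy] _; exists y; rewrite ?inE ?yS.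
    case: noC; have ys := sub y yN; move: yN; rewrite inE => /andP[yS exy].
    case/splitPr: ys ps us Ss yh {sn sub} => s1 s2 ps us Ss yh.
    exists (x :: rcons s1 y); apply/and4P; split.
    - by case: s1 yh {ps us Ss} => [|z s1]; rewrite /= ?eqxx // size_rcons.
    - by move: us; rewrite -cat_rcons -cat_cons cat_uniq => /andP[].
    - move: ps; rewrite -cat_rcons cat_path => /andP[ps _].
      by rewrite /= rcons_path ps last_rcons sym.
    - by move: Ss; rewrite -cat_rcons -cat_cons all_cat => /andP[].
  move: yN; rewrite inE => /andP[yS exy]; exists y, (x :: s); split.
  - by rewrite /= sym exy.
  - by rewrite cons_uniq us inE negb_or ys !andbT; apply: contraTneq exy => ->; rewrite irr.
  - by rewrite /= yS.
  - by rewrite /= sn.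
have [x [s [_ us _ sn]]] := long #|T|.
by have := max_card (mem (x :: s)); rewrite (card_uniqP us) /= sn ltnn.
Qed.

(** Removing a vertex of degree at most one preserves the inequality. *)
Lemma many_arcs_cycle S : S != set0 -> 2 * #|S| < arcs e S + 2 -> exists p, cycle_in S p.
Proof.
have [n] := ubnP #|S|; elim: n S => // n IH S Sn S0 big.
have [/exists_inP[x xS dx] | /exists_inPn deg2] := boolP [exists x in S, #|nbrs e S x| <= 1].
  have cS : #|S| = #|S :\ x|.+1 by rewrite (cardsD1 x) xS.
  have [|||p /and4P[p3 up cp pS]] := IH (S :\ x).
  - by rewrite cS in Sn.
  - apply/eqP=> Sx0; move: big cS; rewrite Sx0 cards0 => + cS.
    by have := arcs_le S irr; rewrite cS; lia.
  - by have := arcs_D1 sym irr xS; lia.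
  exists p; rewrite /cycle_in p3 up cp; apply: sub_all pS => y.
  by rewrite !inE => /andP[].
by apply: mindeg2_cycle => // x /deg2; rewrite -ltnNge.
Qed.

End FindCycle.

Section Noncrossing.
Variable F : sgraph.
Implicit Types (S : {set F}) (f : F -> nat).

(** A layout of the vertices of [S] on a line. Adjacency being symmetric, the last
    clause forbids two interleaved edges, whatever the order of their ends. *)
Definition noncrossing S f := {in S &, injective f} /\
  forall a b c d, a \in S -> b \in S -> c \in S -> d \in S -> adj a b -> adj c d ->
    f a < f c -> f c < f b -> f b < f d -> False.

(** The new vertex is placed immediately to the right of its neighbour; doubling
    the positions makes room for it. *)
Lemma noncrossing_leaf S v f : v \in S -> #|nbrs (@adj F) S v| <= 1 ->
  noncrossing (S :\ v) f -> exists f', noncrossing S f'.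
Proof.
move=> vS dv [inj nc].
have [w only] : exists w, forall x, x \in S -> adj v x -> x = w.
  move/card_le1_eqP: dv => eqN; case: (set_0Vmem (nbrs (@adj F) S v)) => [N0 | [w wN]].
    by exists v => x xS vx; have := in_set0 x; rewrite -N0 inE xS vx.
  by exists w => x xS vx; apply: (eqN w x wN); rewrite inE xS.
have only' x : x \in S -> adj x v -> x = w by rewrite adj_sym; apply: only.
exists (fun x => if x == v then (2 * f w).+1 else 2 * f x); split=> [x y xS yS | a b c d aS bS cS dS ab cd].
  case: (eqVneq x v) => [-> | xv]; case: (eqVneq y v) => [-> | yv] //.
  - by clear; lia.
  - by clear; lia.
  - by move/eqP; rewrite eqn_pmul2l // => /eqP; apply: inj; rewrite !inE ?xv ?yv.
have [av | av] := eqVneq a v.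
  by move: ab; rewrite av => /(only _ bS) ->; do !case: ifP => _; clear; lia.
have [bv | bv] := eqVneq b v.
  by move: ab; rewrite bv => /(only' _ aS) ->; do !case: ifP => _; clear; lia.
have [cv | cv] := eqVneq c v.
  by move: cd; rewrite cv => /(only _ dS) ->; do !case: ifP => _; clear; lia.
have [dv' | dv'] := eqVneq d v.
  by move: cd; rewrite dv' => /(only' _ cS) ->; clear; lia.
by rewrite !ltn_pmul2l //; apply: nc; rewrite // !inE ?av ?bv ?cv ?dv'.
Qed.

Lemma index_next (p : seq F) x : uniq p -> x \in p ->
  index (next p x) p = (index x p).+1 \/
  index (next p x) p = 0 /\ (index x p).+1 = size p.
Proof.
move=> up xp; have := xp; rewrite -index_mem leq_eqVlt => /predU1P[E | lt].
  right; split=> //; rewrite next_nth xp; case: p E {up xp} => // y p' [E].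
  rewrite nth_default; first by rewrite /= eqxx.
  by move: E; rewrite /=; lia.
left; have -> : next p x = nth x p (index x p).+1.
  rewrite next_nth xp; case: p lt {up xp} => // y p' lt.
  exact: set_nth_default.
by rewrite index_uniq.
Qed.

(** The vertices of [p] are placed to the right of all others, in cyclic order: the
    edges of [p] then join consecutive vertices, except for one edge that joins
    the first vertex to the last. *)
Lemma noncrossing_cycle S f (p : seq F) : is_cycle p -> {subset p <= S} ->
  (forall x y, x \in p -> y \in S -> adj x y -> y = next p x \/ y = prev p x) ->
  noncrossing (S :\: [set x in p]) f -> exists f', noncrossing S f'.
Proof.
case/and3P=> p3 up cp pS only [inj nc].
pose M := (\max_(x : F) f x).+1.
have fM x : f x < M by rewrite ltnS; apply: leq_bigmax.
exists (fun x => if x \in p then M + index x p else f x); split=> [x y xS yS | a b c d aS bS cS dS ab cd].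
  case: (boolP (x \in p)) => xp; case: (boolP (y \in p)) => yp.
  - by move/addnI => E; rewrite -(nth_index x xp) -(nth_index x yp) E.
  - by have := fM y; clear; lia.
  - by have := fM x; clear; lia.
  - by apply: inj; rewrite !inE ?xp ?yp.
have closed x y : x \in p -> y \in S -> adj x y -> y \in p.
  by move=> xp yS xy; case: (only x y xp yS xy) => ->; rewrite ?mem_next ?mem_prev.
case: (boolP (a \in p)) => ap.
  have bp : b \in p by apply: closed ab.
  rewrite bp; case: (boolP (c \in p)) => cp'; last by have := fM c; clear; lia.
  have dp : d \in p by apply: closed cd.
  have dsize : index d p < size p by rewrite index_mem.
  rewrite dp !ltn_add2l; move: dsize.
  case: (only a b ap bS ab) => E.
    by have := index_next up ap; rewrite -E; clear; lia.
  have E' : a = next p b by rewrite E next_prev.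
  by have := index_next up bp; rewrite -E'; clear; lia.
have bp : b \notin p by apply: contra ap => bp; apply: closed bp aS _; rewrite adj_sym.
rewrite (negbTE bp); case: (boolP (c \in p)) => cp'; first by have := fM b; clear; lia.
have dp : d \notin p by apply: contra cp' => dp; apply: closed dp cS _; rewrite adj_sym.
by rewrite (negbTE dp); apply: nc; rewrite // !inE ?ap ?bp ?cp' ?dp.
Qed.

(** If a vertex [z] of the cycle [p] had a third neighbour, the component of [z]
    would have more edges than vertices, so it would contain a cycle even without
    one of the edges of [p] at [z]. *)
Lemma pseudoforest_cycle_nbrs S (p : seq F) : pseudoforest F -> is_cycle p -> {subset p <= S} ->
  (forall x, x \in S -> 1 < #|nbrs (@adj F) S x|) ->
  forall x y, x \in p -> y \in S -> adj x y -> y = next p x \/ y = prev p x.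
Proof.
move=> pf Cp pS deg2 z y zp yS zy.
case: (eqVneq y (next p z)) => [-> | yn]; first by left.
case: (eqVneq y (prev p z)) => [-> | yp]; first by right.
exfalso; case/and3P: (Cp) => p3 up cp.
pose eS : rel F := fun u v => [&& u \in S, v \in S & adj u v].
pose K := [set u in S | connect eS z u].
have zS := pS z zp; have zK : z \in K by rewrite inE zS connect0.
have nK : next p z \in K.
  rewrite inE pS ?mem_next //; apply: connect1; rewrite /eS zS pS ?mem_next //=.
  exact: next_cycle.
have adjn : adj z (next p z) by apply: next_cycle.
have nbrsK u : u \in K -> nbrs (@adj F) K u = nbrs (@adj F) S u.
  rewrite inE => /andP[uS zu]; apply/setP=> w; rewrite !inE.
  case wS: (w \in S) => //=; case uw: (adj u w); rewrite ?andbF ?andbT //.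
  by apply: connect_trans zu (connect1 _); rewrite /eS uS wS.
have deg3 : 2 < #|nbrs (@adj F) K z|.
  have np : next p z != prev p z.
    apply: contraNneq (next_next_neq up p3 zp) => ->.
    by rewrite next_prev.
  rewrite nbrsK //; apply: (@leq_trans #|[set y; next p z; prev p z]|).
    by rewrite -setUA cardsU1 cards2 !inE negb_or yn yp np.
  apply: subset_leq_card; apply/subsetP => w; rewrite !inE -orbA => /or3P[] /eqP->.
  - by rewrite yS.
  - by rewrite adjn pS ?mem_next.
  - by rewrite pS ?mem_prev //= adj_sym; apply: prev_cycle.
have manyK : 2 * #|K| < arcs (@adj F) K.
  rewrite /arcs (big_setD1 z) //= (cardsD1 z) zK mulnDr muln1.
  rewrite -addSn leq_add // mulnC -sum_nat_const; apply: leq_sum => u.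
  by rewrite inE => /andP[_ uK]; rewrite nbrsK // deg2 //; move: uK; rewrite inE => /andP[].
pose e' := del_edge (@adj F) z (next p z).
have [||||q /and4P[q3 uq cq qK]] := @many_arcs_cycle _ e' _ _ K.
- exact/del_edge_sym/adj_sym.
- by move=> u; rewrite /e' /del_edge adj_irrefl.
- by apply/set0Pn; exists z.
- move: manyK; rewrite (arcs_del_edge (@adj_sym F) (@adj_irrefl F) zK nK adjn) -/e'.
  by move: (arcs e' K) => m; clear; lia.
have Cq : is_cycle q.
  by rewrite /is_cycle q3 uq; apply: sub_cycle cq => u v /andP[].
have [y0 y0q] : exists y0, y0 \in q by case: q q3 {uq cq qK Cq} => // y0 q _; exists y0; rewrite mem_head.
have con : connect adj z y0.
  have : y0 \in K by apply: (allP qK).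
  by rewrite inE => /andP[_]; apply: connect_sub => u v /and3P[_ _ uv]; apply: connect1.
have := pf p q Cp Cq (ex_intro _ z (ex_intro _ y0 (And3 zp y0q con))).
move/setP/(_ [set z; next p z]).
have -> : [set z; next p z] \in cycle_edges p by apply/imsetP; exists z.
move/esym/imsetP => [w wq E].
by have := next_cycle cq wq; rewrite /e' /del_edge E eqxx andbF.
Qed.

(** Remove a vertex of degree at most one as long as there is one; then every cycle
    is a component, and can be removed as a whole. *)
Lemma pseudoforest_noncrossing S : pseudoforest F -> exists f, noncrossing S f.
Proof.
move=> pf; have [n] := ubnP #|S|; elim: n S => // n IH S Sn.
have [-> | S0] := eqVneq S set0.
  by exists (fun=> 0); split=> [x y | a b c d]; rewrite inE.
have [/exists_inP[v vS dv] | /exists_inPn deg2] := boolP [exists x in S, #|nbrs (@adj F) S x| <= 1].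
  have [|f nf] := IH (S :\ v); last exact: noncrossing_leaf nf.
  by rewrite (cardsD1 v) vS in Sn.
have {}deg2 x : x \in S -> 1 < #|nbrs (@adj F) S x| by move/deg2; rewrite -ltnNge.
have [p /and4P[p3 up cp /allP pS]] := mindeg2_cycle (@adj_sym F) (@adj_irrefl F) S0 deg2.
have Cp : is_cycle p by apply/and3P.
have [|f nf] := IH (S :\: [set x in p]); last first.
  exact: noncrossing_cycle Cp pS (pseudoforest_cycle_nbrs pf Cp pS deg2) nf.
rewrite -ltnS; apply: leq_ltn_trans Sn; apply: proper_card; apply/properP; split; first exact: subsetDl.
by case: p p3 pS {up cp Cp} => // x p _ pS; exists x; [apply: pS; rewrite mem_head | rewrite !inE eqxx].
Qed.

End Noncrossing.

(** * Chords of a parabola *)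

Section Parabola.
Variable R : realType.
Local Open Scope classical_set_scope.
Local Open Scope ring_scope.

(** The segment between the points of abscissae [x] and [y] on the parabola. *)
Definition chord (x y : R) : set (R * R) :=
  [set P | (P.1 - x) * (P.1 - y) <= 0 /\ P.2 = (x + y) * P.1 - x * y].

Lemma chordC x y : chord x y = chord y x.
Proof.
by apply/seteqP; split=> P [h1 h2]; split; rewrite 1?mulrC // h2; ring.
Qed.

Lemma chord_arc (x y : R) : x != y -> arc_between (x, x ^+ 2) (y, y ^+ 2) (chord x y).
Proof.
move=> xy; have yx : y - x != 0 by rewrite subr_eq0 eq_sym.
have aff (a b : R) : continuous (fun s : R => a + s * b).
  by move=> s; apply: cvgD; [exact: cvg_cst | apply: cvgM; [exact: cvg_id | exact: cvg_cst]].
exists (fun s => (x + s * (y - x), x ^+ 2 + s * (y ^+ 2 - x ^+ 2))); split.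
- apply: continuous_subspaceT => s; apply: (cvg_pair (aff x _ s) (aff (x ^+ 2) _ s)).
- by move=> s t _ _ [/addrI /(mulIf yx)].
- by rewrite !mul0r !addr0.
- by rewrite !mul1r !subrKC.
- apply/seteqP; split=> [[u v] /= [/= h1 h2] | _ [s /= s01 <-]].
    exists ((u - x) / (y - x)) => /=.
      have sq : 0 < (y - x) ^+ 2 by rewrite exprn_even_gt0.
      have e1 : (u - x) / (y - x) * (y - x) ^+ 2 = (u - x) * (y - x) by field.
      rewrite in_itv /=; apply/andP; split.
        by rewrite -(pmulr_lge0 _ sq) e1; nra.
      by rewrite -(ler_pM2r sq) e1 mul1r; nra.
    by congr pair; [field | rewrite h2; field].
  move: s01; rewrite in_itv /= => /andP[s0 s1]; split=> /=; last by ring.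
  have -> : (x + s * (y - x) - x) * (x + s * (y - x) - y) = - (s * (1 - s) * (y - x) ^+ 2) by ring.
  by rewrite oppr_le0 mulr_ge0 ?sqr_ge0 // mulr_ge0 // subr_ge0.
Qed.

Lemma chord_vertex (x y z : R) : chord x y (z, z ^+ 2) -> z = x \/ z = y.
Proof.
move=> [_ /= h]; have /eqP : (z - x) * (z - y) = 0 by rewrite -[RHS](subrr (z ^+ 2)) {2}h; ring.
by rewrite mulf_eq0 !subr_eq0 => /orP[/eqP | /eqP]; [left | right].
Qed.

Definition interleave (x y z t : R) := [&& x < z, z < y & y < t].

(** On the chord from [x] to [y] the height above the parabola at abscissa [u] is
    [(u - x) * (y - u)]. For nested chords the outer one is strictly higher,
    except at a common end. *)
Lemma chords_meet_le (x y z t : R) (P : R * R) : x <= z -> x < y -> z < t ->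
  ~~ interleave x y z t -> (x != z) || (y != t) -> chord x y P -> chord z t P ->
  exists2 w : R, (w = x \/ w = y) /\ (w = z \/ w = t) & P = (w, w ^+ 2).
Proof.
case: P => u v; rewrite /chord /interleave /= => xz xy zt nint ne [a1 a2] [b1 b2].
have [xu uy] : x <= u /\ u <= y by split; nra.
have [zu ut] : z <= u /\ u <= t by split; nra.
(* Both chords have the same height at the common point. *)
have E : (u - x) * (y - u) = (u - z) * (t - u).
  have -> : (u - x) * (y - u) = (x + y) * u - x * y - u ^+ 2 by ring.
  by rewrite -a2 b2; ring.
have on_x : u = x -> v = x ^+ 2 by move=> ux; rewrite a2 ux; ring.
have on_y : u = y -> v = y ^+ 2 by move=> uy'; rewrite a2 uy'; ring.
have [xz' | xz'] := eqVneq x z.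
  have yt : y != t by move: ne; rewrite xz' eqxx.
  have /eqP : (u - x) * (y - t) = 0 by move: E; rewrite -xz'; lra.
  rewrite mulf_eq0 !subr_eq0 (negbTE yt) orbF => /eqP ux.
  by exists x; [split; left | rewrite on_x ux].
have {xz xz'} xz : x < z by rewrite lt_neqAle xz'.
have [yz | zy] := leP y z.
  have uy' : u = y by lra.
  by exists y; [split; [right | left; lra] | rewrite on_y ?uy'].
have ty : t <= y by move: nint; rewrite xz zy /= -leNgt.
have /eqP : (z - x) * (t - u) = 0 by apply/eqP; rewrite eq_le; apply/andP; split; nra.
rewrite mulf_eq0 !subr_eq0 (gt_eqF xz) /= => /eqP tu.
have /eqP : (u - x) * (y - u) = 0 by rewrite E tu subrr mulr0.
rewrite mulf_eq0 !subr_eq0 gt_eqF /=; last by lra.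
move=> /eqP yu; exists y; first by split; right; lra.
by rewrite on_y ?yu.
Qed.

Lemma chords_meet (x y z t : R) (P : R * R) : x < y -> z < t ->
  ~~ interleave x y z t -> ~~ interleave z t x y -> (x != z) || (y != t) ->
  chord x y P -> chord z t P ->
  exists2 w : R, (w = x \/ w = y) /\ (w = z \/ w = t) & P = (w, w ^+ 2).
Proof.
move=> xy zt n1 n2 ne c1 c2; have [xz | /ltW zx] := leP x z.
  exact: (chords_meet_le xz xy zt).
have ne' : (z != x) || (t != y) by rewrite (eq_sym z) (eq_sym t).
by have [w [w1 w2] Pw] := chords_meet_le zx zt xy n2 ne' c2 c1; exists w.
Qed.

Lemma noncrossing_planar (K : sgraph) (f : K -> nat) : injective f ->
  (forall a b c d : K, adj a b -> adj c d ->
     (f a < f c)%N -> (f c < f b)%N -> (f b < f d)%N -> False) ->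
  planar R K.
Proof.
move=> finj nc; pose r (x : K) : R := (f x)%:R.
have rinj : injective r by move=> x y /eqP; rewrite eqr_nat => /eqP /finj.
have nint a b c d : adj a b -> adj c d -> ~~ interleave (r a) (r b) (r c) (r d).
  move=> ab cd; apply/negP; rewrite /interleave !ltr_nat => /and3P[].
  exact: nc ab cd.
have adj_neq (x y : K) : adj x y -> x != y by apply: contraTneq => ->; rewrite adj_irrefl.
pose arc (e : {set K}) : set (R * R) :=
  [set P | exists x y : K, e = [set x; y]%SET /\ chord (r x) (r y) P].
have arcE x y : arc [set x; y]%SET = chord (r x) (r y).
  apply/seteqP; split=> [P [u [v [/eqP]]] | P cP]; last by exists x, y.
  by rewrite set2_eq => /orP[] /andP[/eqP-> /eqP->] //; rewrite chordC.
exists (fun x => (r x, r x ^+ 2)), arc; split.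
- by move=> x y [/rinj].
- move=> x y xy; rewrite arcE; apply: chord_arc.
  by apply: contraNneq (adj_neq _ _ xy) => /rinj ->; rewrite eqxx.
- move=> x y z xy; rewrite arcE => /chord_vertex[] /rinj ->; rewrite !inE eqxx ?orbT //.
- move=> x y z w.
  wlog xy_lt : x y / r x < r y.
    move=> H xy; have := adj_neq _ _ xy; rewrite -(inj_eq rinj) neq_lt => /orP[lt | lt].
      exact: H lt xy.
    rewrite finset.setUC; apply: H lt _; by rewrite adj_sym.
  wlog zw_lt : z w / r z < r w.
    move=> H xy zw; have := adj_neq _ _ zw; rewrite -(inj_eq rinj) neq_lt => /orP[lt | lt].
      exact: H lt xy zw.
    rewrite (finset.setUC [set z]%SET); apply: H lt xy _; by rewrite adj_sym.
  move=> xy zw ne P; rewrite !arcE => P1 P2.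
  have ne' : (r x != r z) || (r y != r w).
    by rewrite !(inj_eq rinj) -negb_and; apply: contra ne => /andP[/eqP-> /eqP->].
  have [v [v1 v2] ->] := chords_meet xy_lt zw_lt (nint _ _ _ _ xy zw) (nint _ _ _ _ zw xy) ne' P1 P2.
  have [u uv u1] : exists2 u, v = r u & u \in [set x; y]%SET.
    by case: v1 => ->; [exists x | exists y]; rewrite // !inE eqxx ?orbT.
  exists u; last by rewrite uv.
  rewrite finset.in_setI u1 /=; move: v2; rewrite uv => -[] /rinj ->; by rewrite !inE eqxx ?orbT.
Qed.

End Parabola.

(** * Splitting a graph along an edge colouring *)

Section SplitByColour.
Variables (R : realType) (G : sgraph) (k : nat) (c : {set G} -> 'I_k.+1).
Implicit Types D : {set G}.

(** The copies [(v, i)] of the vertices of [D], one for each colour, and the single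
    copy [(v, ord0)] of any other vertex. *)
Definition copy D := {x : G * 'I_k.+1 | (x.1 \in D) || (x.2 == ord0)}.
HB.instance Definition _ D := SubFinite.on (copy D).

Definition copy_adj D : rel (copy D) := fun x y =>
  let a := val x in let b := val y in
  [&& adj a.1 b.1, (a.1 \in D) ==> (c [set a.1; b.1] == a.2) &
      (b.1 \in D) ==> (c [set a.1; b.1] == b.2)].

Lemma copy_adj_sym D : symmetric (@copy_adj D).
Proof.
move=> x y; rewrite /copy_adj adj_sym (setUC [set (val x).1]).
by rewrite [X in _ && X]andbC.
Qed.

Lemma copy_adj_irrefl D : irreflexive (@copy_adj D).
Proof. by move=> x; rewrite /copy_adj adj_irrefl. Qed.

(** The graph in which exactly the vertices of [D] have been split, the copy
    [(v, i)] keeping the edges of colour [i]. *)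
Definition split_graph D := SGraph (@copy_adj_sym D) (@copy_adj_irrefl D).

Definition isomorphism (X Y : sgraph) (g : X -> Y) :=
  bijective g /\ forall x y, adj x y = adj (g x) (g y).

Hypothesis layout : forall i, exists f, noncrossing [set: color_class c i] f.

(** The components of the fully split graph are monochromatic, so the layouts of
    the colour classes can be put next to each other, in blocks of width [M]. *)
Lemma planar_split_all (X : sgraph) (g : X -> split_graph [set: G]) :
  isomorphism g -> planar R X.
Proof.
move=> [gbij gadj].
have [f fP] := @boolp.choice _ (G -> nat)
  (fun i f => @noncrossing (color_class c i) [set: color_class c i] f) layout.
pose M := (\max_(p : 'I_k.+1 * G) f p.1 p.2).+1.
have fM i x : f i x < M by rewrite ltnS; apply: (@leq_bigmax _ (fun p : 'I_k.+1 * G => f p.1 p.2) (i, x)).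
pose h (x : X) := let a := val (g x) in a.2 * M + f a.2 a.1.
have hdiv x : h x %/ M = (val (g x)).2.
  by rewrite /h divnMDl // divn_small ?addn0.
have hmod x : h x %% M = f (val (g x)).2 (val (g x)).1.
  by rewrite /h modnMDl modn_small.
apply: (@noncrossing_planar R X h).
  move=> x y hxy; have [ginv gK _] := gbij; apply: (can_inj gK); apply: val_inj.
  have e2 : (val (g x)).2 = (val (g y)).2 by apply: val_inj; rewrite /= -!hdiv hxy.
  have := hmod x; rewrite hxy hmod e2 => /(proj1 (fP _)) e1.
  by rewrite [LHS]surjective_pairing [RHS]surjective_pairing e2 e1 // inE.
have colour x y : adj x y -> (val (g x)).2 = (val (g y)).2 /\
    @adj (color_class c (val (g x)).2) (val (g x)).1 (val (g y)).1.
  rewrite gadj /= /copy_adj => /and3P[xy]; rewrite !inE /= => /eqP <- /eqP <-.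
  by rewrite /class_adj xy eqxx.
move=> a b u v /colour[ab1 ab2] /colour[cd1 cd2] ac cb bd.
have abu : (val (g a)).2 = (val (g u)).2.
  have := leq_div2r M (ltnW ac); have := leq_div2r M (ltnW cb).
  by rewrite !hdiv -ab1 => le1 le2; apply: val_inj; apply/eqP; rewrite eqn_leq le1 le2.
move: ac cb bd cd2; rewrite /h -cd1 -ab1 -abu !ltn_add2l => ac cb bd cd2.
by apply: (proj2 (fP (val (g a)).2) _ _ _ _ _ _ _ _ ab2 cd2 ac cb bd); rewrite inE.
Qed.

(** Induction on the number of vertices that have not been split. The graph [X] is
    only isomorphic to the intermediate graph because a chain of splits starts at
    the graph [G] itself, while [split_graph set0] is a copy of [G]. *)
Lemma splits_to_planar D (X : sgraph) (g : X -> split_graph D) : isomorphism g ->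
  exists2 K, splits_on k.+1 [set x | (val (g x)).1 \notin D] K & planar R K.
Proof.
have [n] := ubnP #|~: D|; elim: n D X g => // n IH D X g Dn iso.
have [D0 | [v vD]] := set_0Vmem (~: D).
  have DT : D = setT by rewrite -[D]setCK D0 setC0.
  move: g iso; rewrite DT => g iso; exists X; first exact: SplitsNil.
  exact: planar_split_all iso.
have nvD : v \notin D by rewrite inE in vD.
have [[ginv gK ginvK] gadj] := iso.
pose D' := v |: D; pose H := split_graph D'.
have collP (y : H) : ((val y).1 \in D) || ((if (val y).1 == v then ord0 else (val y).2) == ord0).
  have := valP y; rewrite /= in_setU1; case: (eqVneq (val y).1 v) => //= _.
  by rewrite orbT.
pose coll (y : H) : split_graph D :=
  exist _ ((val y).1, if (val y).1 == v then ord0 else (val y).2) (collP y).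
(* Splitting [v] is undone by sending all its copies to the one with colour 0. *)
pose pi (y : H) : X := ginv (coll y).
have gpi y : val (g (pi y)) = ((val y).1, if (val y).1 == v then ord0 else (val y).2).
  by rewrite /pi ginvK.
pose v' : X := ginv (exist _ (v, ord0) (introT orP (or_intror (eqxx ord0)))).
have gv' : val (g v') = (v, ord0) by rewrite /v' ginvK.
have ginj : injective g := can_inj gK.
have at_v x : (x == v') = ((val (g x)).1 == v).
  rewrite -(inj_eq ginj) -val_eqE /= gv'; apply/eqP/eqP => [-> // | e].
  have := valP (g x); rewrite e (negbTE nvD) /= => /eqP e2.
  by rewrite [LHS]surjective_pairing e e2.
have piv y : (pi y == v') = ((val y).1 == v) by rewrite at_v gpi.
have spl : split_op k.+1 v' pi.
  split.
  - move=> w wv; rewrite at_v in wv.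
    have wD' : ((val (g w)).1 \in D') || ((val (g w)).2 == ord0).
      by have := valP (g w); rewrite in_setU1 (negbTE wv).
    rewrite -(card1 (exist _ (val (g w)) wD' : H)); apply: eq_card => y; rewrite !inE.
    apply/eqP/eqP => [piyw | ->].
      have E := gpi y; rewrite piyw in E; rewrite E /= in wv.
      by apply: val_inj; rewrite /= E (negbTE wv) -surjective_pairing.
    by apply: ginj; apply: val_inj; rewrite gpi /= (negbTE wv) -surjective_pairing.
  - have colinj : {in [pred y : H | pi y == v'] &, injective (fun y : H => (val y).2)}.
      move=> x y; rewrite !inE !piv => /eqP xv /eqP yv e; apply: val_inj.
      by rewrite [LHS]surjective_pairing [RHS]surjective_pairing xv yv e.
    rewrite -(card_in_imset colinj) -[X in _ <= X]card_ord; exact: max_card.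
  - move=> x y; rewrite !piv => xv yv; rewrite gadj /= /copy_adj !gpi /= !in_setU1.
    by rewrite (negbTE xv) (negbTE yv).
  - move=> x y /eqP; rewrite piv gadj /= => /eqP xv /and3P[xy _ yc].
    have yv : (val y).1 != v by apply: contraTneq xy => ->; rewrite xv adj_irrefl.
    rewrite /copy_adj gv' gpi /= (negbTE yv) (negbTE nvD) -xv xy /=.
    by move: yc; rewrite in_setU1 (negbTE yv).
  - move=> y; rewrite gadj /= /copy_adj gv' gpi /= (negbTE nvD) /= => /andP[vy yc].
    have yv : (val y).1 != v by apply: contraTneq vy => ->; rewrite adj_irrefl.
    have xD' : (v \in D') || (c [set v; (val y).1] == ord0) by rewrite setU11.
    pose x : H := exist (fun x : G * 'I_k.+1 => (x.1 \in D') || (x.2 == ord0)) (v, _) xD'.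
    exists x; first by apply/eqP; rewrite piv /=.
    by rewrite /= /copy_adj /= vy eqxx implybT in_setU1 (negbTE yv); move: yc; rewrite (negbTE yv).
have isoH : isomorphism (id : H -> split_graph D') by split=> //; exists id.
have [|K spK plK] := IH D' H id _ isoH.
  rewrite -ltnS; apply: leq_ltn_trans Dn; apply: proper_card; apply/properP; split.
    by apply/subsetP=> x; rewrite !inE negb_or => /andP[].
  by exists v => //; rewrite !inE eqxx.
exists K => //; apply: SplitsCons spl _; first by rewrite inE gv'.
suff -> : pi @^-1: ([set x | (val (g x)).1 \notin D] :\ v') = [set x : H | (val x).1 \notin D'] by [].
apply/setP=> y; rewrite !inE piv gpi /= negb_or.
by case: eqP => [-> | _].
Qed.

Lemma noncrossing_splittable : splittable R k.+1 G.
Proof.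
have cP (v : G) : (v \in set0) || (ord0 == ord0 :> 'I_k.+1) by rewrite eqxx orbT.
pose g (v : G) : split_graph set0 := exist _ (v, ord0) (cP v).
have iso : isomorphism g.
  split.
    exists (fun x => (val x).1) => // x; apply: val_inj => /=.
    have := valP x; rewrite /= inE /= => /eqP e.
    by rewrite [RHS]surjective_pairing e.
  by move=> x y; rewrite /= /copy_adj /= !inE andbT.
have [K spK plK] := splits_to_planar iso; exists K => //.
suff E : [set x : G | (val (g x)).1 \notin set0] = [set: G] by rewrite E in spK.
by apply/setP=> x; rewrite !inE.
Qed.

End SplitByColour.

Lemma pseudoforests_splittable (R : realType) (G : sgraph) (k : nat) : 0 < k ->
  decomposes pseudoforest G k -> splittable R k G.
Proof.
case: k => // k _ [c pf]; apply: (@noncrossing_splittable _ _ _ c) => i.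
exact: pseudoforest_noncrossing.
Qed.

(** * Arboricity and planar split thickness *)

(** Up to [6 * k + 2] vertices, the density of the complete graph suffices; from
    there on, [3 * k * #|W|] is at most [(3 * k + 1) * (#|W| - 1)]. *)
Lemma sparse_forests (G : sgraph) (k : nat) :
  (forall S : {set G}, arcs (@adj G) S <= 6 * k * #|S|) -> decomposes forest G (3 * k + 1).
Proof.
move=> sparse; apply: nash_williams => [|W W1]; first by rewrite addn1.
have := edges_in_arcs W; have := sparse W; have := arcs_le W (@adj_irrefl G).
move: (arcs _ W) #|edges_in W| #|W| W1 => a b [//|w] _ /= a1 a2 b1.
have [small | large] := leqP w (6 * k + 1); nia.
Qed.

Lemma forest_pseudoforest (F : sgraph) : forest F -> pseudoforest F.
Proof. by move=> acyc p q /(negP (acyc p)). Qed.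

(** This makes the planar split thickness of every graph well defined. *)
Lemma pseudoforests_exist (G : sgraph) : decomposes pseudoforest G #|G|.+1.
Proof.
apply: sparse_pseudoforests => // S; apply: leq_trans (arcs_le S (@adj_irrefl G)) _.
have : #|S| <= #|G| by apply: max_card.
by move: #|S| #|G|; nia.
Qed.

Lemma splittable_bounds (R : realType) (G : sgraph) (k : nat) : 0 < k -> splittable R k G ->
  [/\ 0 < arboricity G, decomposes forest G (arboricity G) & arboricity G <= 3 * k + 1] /\
  [/\ 0 < pseudoarboricity G, decomposes pseudoforest G (pseudoarboricity G) & pseudoarboricity G <= 3 * k].
Proof.
move=> k0 /(@splittable_arcs R k G _ k0) sparse; split.
  have F := sparse_forests sparse; have n0 : 0 < 3 * k + 1 by rewrite addn1.
  have [|a0 aF amin] := @least_posP (decomposes forest G); first by exists (3 * k + 1).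
  by split=> //; apply: amin.
have n0 : 0 < 3 * k by rewrite muln_gt0.
have F : decomposes pseudoforest G (3 * k).
  by apply: sparse_pseudoforests => // S; rewrite mulnA; apply: sparse.
have [|a0 aF amin] := @least_posP (decomposes pseudoforest G); first by exists (3 * k).
by split=> //; apply: amin.
Qed.

Theorem theorem6 (R : realType) (G : sgraph) :
  (forall k : nat, 0 < k -> splittable R k G ->
     arboricity G <= 3 * k + 1 /\ pseudoarboricity G <= 3 * k) /\
  (forall k : nat, k = planar_split_thickness R G ->
     (k <= arboricity G /\
      ((arboricity G)%:R <= (3 + 1 / k%:R) * k%:R :> R)%R) /\
     (k <= pseudoarboricity G /\ pseudoarboricity G <= 3 * k)).
Proof.
split=> [k k0 spl | k ->].
  by have [[_ _ a] [_ _ p]] := splittable_bounds k0 spl.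
have spl := pseudoforests_splittable R (ltn0Sn #|G|) (pseudoforests_exist G).
have [|k0 kspl kmin] := @least_posP (fun k => splittable R k G); first by exists #|G|.+1.
rewrite -/(planar_split_thickness R G) in k0 kspl kmin.
move: (planar_split_thickness R G) k0 kspl kmin => {spl} k k0 kspl kmin.
have [[a0 aF a3] [p0 pF p3]] := splittable_bounds k0 kspl; do 2!split=> //.
- apply: kmin => //; apply: pseudoforests_splittable => //.
  by have [c cF] := aF; exists c => i; apply: forest_pseudoforest.
- have k0' : (k%:R != 0 :> R)%R by rewrite pnatr_eq0 -lt0n.
  by rewrite mulrDl div1r mulVf // -natrM -[1%R]/(1%:R)%R -natrD ler_nat.
- by apply: kmin => //; apply: pseudoforests_splittable.
Qed.
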